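(* For every element $g\in\mathcal G$ of infinite order, the translation length satisfies $\tau(g)\ge \frac{1}{2\delta}$, where $\delta$ is the word length of $\Delta$.
   Context: Let $\mathcal A$ be an Artin group of finite type with generating set $S$ and associated finite Coxeter group $\mathcal W$; $\mathcal A^+$ is the submonoid generated by $S$, and $x<y$ means $y=xz$ with $z\in\mathcal A^+$. An atom is an element of $\mathcal A^+$ whose $S$-word length equals the length of its image in $\mathcal W$; $\Delta$ is the atom mapping to the longest element of $\mathcal W$ ($\Delta^2$ central). For $g\in\mathcal A^+$, $\alpha(g)$ is the largest (for $<$) atom with $\alpha(g)<g$; the normal form of $g$ is $g=A_1\cdot\ldots\cdot A_k$ with nontrivial atoms and $A_i=\alpha(A_i\cdots A_k)$. Let $\mathcal G=\mathcal A/\langle\Delta^2\rangle$ act on $V=\mathcal A/\langle\Delta\rangle$ by left multiplication, $*=\langle\Delta\rangle$. Each $v\in V$ has a unique special representative in $\mathcal A^+$ whose normal form contains no $\Delta$; its word length is the wordnorm $\|v\|$. The translation length of $g\in\mathcal G$ is $\tau(g)=\lim_{n\to\infty}\|g^n( * )\|/n$. *)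

(* Defs.v *)
From mathcomp Require Import all_boot.
From Stdlib Require Import Relations Reals.
Set Implicit Arguments. Unset Strict Implicit. Unset Printing Implicit Defensive.

Section ArtinCoxeter.
Variables (S : finType) (m : S -> S -> nat).

Definition alt (s t : S) (k : nat) : seq S :=
  mkseq (fun i => if odd i then t else s) k.

Inductive cox_step : seq S -> seq S -> Prop :=
| cox_sq x y s : cox_step (x ++ [:: s; s] ++ y) (x ++ y)
| cox_braid x y s t : s != t ->
    cox_step (x ++ alt s t (m s t) ++ y) (x ++ alt t s (m s t) ++ y).

Definition ceq : seq S -> seq S -> Prop := clos_refl_sym_trans _ cox_step.

Definition coxeter_finite : Prop :=
  exists L : seq (seq S), forall w, exists2 v, v \in L & ceq w v.

Definition letter := (S * bool)%type. (* (s,true) = s, (s,false) = s^-1 *)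

Inductive art_step : seq letter -> seq letter -> Prop :=
| art_cancel x y s b : art_step (x ++ [:: (s, b); (s, ~~ b)] ++ y) (x ++ y)
| art_braid x y s t : s != t ->
    art_step (x ++ [seq (u, true) | u <- alt s t (m s t)] ++ y)
             (x ++ [seq (u, true) | u <- alt t s (m s t)] ++ y).

Definition aeq : seq letter -> seq letter -> Prop :=
  clos_refl_sym_trans _ art_step.

Definition pos (w : seq S) : seq letter := [seq (u, true) | u <- w].
Definition inv (w : seq letter) : seq letter :=
  rev [seq (x.1, ~~ x.2) | x <- w].
Definition wpow (w : seq letter) (n : nat) : seq letter := flatten (nseq n w).

Definition pdiv (x y : seq S) : Prop := exists z : seq S, aeq (pos (x ++ z)) (pos y).

Definition atom (a : seq S) : Prop := forall v, ceq v a -> size a <= size v.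

Definition is_alpha (a y : seq S) : Prop :=
  atom a /\ pdiv a y /\ forall b, atom b -> pdiv b y -> pdiv b a.

Definition normal_form (L : seq (seq S)) (p : seq S) : Prop :=
  aeq (pos (flatten L)) (pos p) /\
  (forall a, a \in L -> atom a /\ ~ aeq (pos a) [::]) /\
  (forall i, i < size L -> is_alpha (nth [::] L i) (flatten (drop i L))).

(* Delta: the atom mapping to the longest element of W *)
Definition isDelta (d : seq S) : Prop :=
  atom d /\ forall w : seq S, exists2 v, ceq v w & size v <= size d.

Definition dpowZ (d : seq S) (k : Z) : seq letter :=
  match k with
  | Z0 => [::]
  | Zpos q => wpow (pos d) (Pos.to_nat q)
  | Zneg q => wpow (inv (pos d)) (Pos.to_nat q)
  end.

(* p is the special representative of the coset x<Delta> in V = A/<Delta> *)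
Definition special_rep (d : seq S) (x : seq letter) (p : seq S) : Prop :=
  (exists k : Z, aeq (pos p) (x ++ dpowZ d k)) /\
  exists2 L, normal_form L p & forall a, a \in L -> ~ aeq (pos a) (pos d).

Definition wordnorm (d : seq S) (x : seq letter) (k : nat) : Prop :=
  exists p, special_rep d x p /\ size p = k.

(* g (mod Delta^2) has infinite order in G = A/<Delta^2> *)
Definition infinite_order_G (d : seq S) (g : seq letter) : Prop :=
  forall n k, 0 < n -> ~ aeq (wpow g n) (dpowZ d (2 * k)).

End ArtinCoxeter.

(* Main.v *)
(* The element [Delta ^ 2] is central and the exponent sum is a homomorphism, so
   [y = g ^ (2 delta) Delta ^ (- 2 e(g))] has exponent sum 0, and [y <> 1] since
   [g] has infinite order. For such a [y] the meets
   [z_j = 1 /\ y /\ ... /\ y ^ j] in the lattice of left divisibility satisfy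
   [z_(j+1) = 1 /\ y z_j]; if [z_(j+1) = z_j] then [z_j] divides [y z_j], which
   has the same exponent sum, so [y = 1]. Hence the exponent sum of [z_j] is at
   most [- j]. If [y ^ n = p Delta ^ (- k)] with [p] positive, the powers of [y]
   are bounded below by powers of [Delta] of slope [- k / n], and comparing with
   [z_j] gives [n <= delta k = |p|]. So [||g ^ (2 delta n)|| >= n], and
   subadditivity of the wordnorm gives [n <= 2 delta ||g ^ n||].

   The lattice structure is Garside's: the exchange condition (by parity of
   reflections) makes the weak order of the finite Coxeter group a lattice, and
   reduced words give a section [lift] of the projection of the positive monoid.
   The positive monoid acts on sequences of Coxeter group elements by
   left-greedy multiplication; the orbit map of the empty sequence computes the
   normal form, from which left cancellation and least common multiples follow.
   The orders of the products of two generators are found with the action on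
   the dual of the geometric representation. *)
From Stdlib Require Import Reals ZArith Lra Relations ClassicalEpsilon.
From Stdlib Require Import FunctionalExtensionality PropExtensionality.
From HB Require Import structures.
From mathcomp Require Import all_boot zify.
Require Import Defs.
Set Implicit Arguments. Unset Strict Implicit. Unset Printing Implicit Defensive.
Local Open Scope group_scope.

(** * Quotients of free monoids *)

Record presentation (T : choiceType) := Presentation {
  step : seq T -> seq T -> Prop;
  step_context : forall x y u v,
    step u v -> step (x ++ u ++ y) (x ++ v ++ y) }.

Section Quotient.
Variables (T : choiceType) (P : presentation T).

Definition congr : seq T -> seq T -> Prop := clos_refl_sym_trans _ (step P).

Lemma congr_context x y u v : congr u v -> congr (x ++ u ++ y) (x ++ v ++ y).
Proof.
elim=> [{}u {}v h|{}u|{}u {}v _ h|{}u w {}v _ h1 _ h2].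
- exact/rst_step/step_context.
- exact: rst_refl.
- exact: rst_sym.
- exact: rst_trans h1 h2.
Qed.

Lemma congr_cat u u' v v' : congr u u' -> congr v v' -> congr (u ++ v) (u' ++ v').
Proof.
move=> hu hv; apply: (@rst_trans _ _ _ (u' ++ v)).
  by have := congr_context [::] v hu.
by have := congr_context u' [::] hv; rewrite !cats0.
Qed.

(** Congruent words define the same predicate by extensionality, so choice selects the same word for
    both; classes are then encoded as the words fixed by [canon]. *)
Definition canon (w : seq T) : seq T := epsilon (inhabits w) (congr w).

Lemma canonP w : congr w (canon w).
Proof. by apply: epsilon_spec; exists w; apply: rst_refl. Qed.

Lemma canon_eq u v : congr u v <-> canon u = canon v.
Proof.
split=> [h|h]; last first.
  by apply: rst_trans (canonP u) _; rewrite h; apply/rst_sym/canonP.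
have E : congr u = congr v.
  apply: functional_extensionality => w; apply: propositional_extensionality.
  split=> k; last exact: rst_trans h k.
  by apply: rst_trans k; apply: rst_sym.
rewrite /canon E; apply: epsilon_inh_irrelevance.
by exists v; apply: rst_refl.
Qed.

Definition quotient := {w : seq T | w == canon w}.
HB.instance Definition _ := Choice.on quotient.

Fact canon_idem w : canon w == canon (canon w).
Proof. by apply/eqP/canon_eq; apply: canonP. Qed.

Definition cls (w : seq T) : quotient := Sub (canon w) (canon_idem w).
Definition repr (x : quotient) : seq T := val x.

Lemma reprK : cancel repr cls.
Proof. by move=> x; apply: val_inj; rewrite /= [RHS](eqP (valP x)). Qed.

Lemma clsP u v : cls u = cls v <-> congr u v.
Proof.
split=> [/(congr1 val) /= /canon_eq //|/canon_eq h].
exact: val_inj.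
Qed.

Lemma repr_cls w : congr (repr (cls w)) w.
Proof. by apply/clsP; rewrite reprK. Qed.

Definition qmul x y := cls (repr x ++ repr y).

Lemma cls_cat u v : cls (u ++ v) = qmul (cls u) (cls v).
Proof. by apply/clsP/congr_cat; apply/rst_sym/repr_cls. Qed.

Fact qmulA : associative qmul.
Proof.
move=> x y z; rewrite -[x]reprK -[y]reprK -[z]reprK.
by rewrite -!cls_cat catA.
Qed.

Fact qmul1 : left_id (cls [::]) qmul.
Proof. by move=> x; rewrite -[x]reprK -cls_cat. Qed.

Fact q1mul : right_id (cls [::]) qmul.
Proof. by move=> x; rewrite -[x]reprK -cls_cat cats0. Qed.

HB.instance Definition _ := isMonoid.Build quotient qmulA qmul1 q1mul.

Lemma clsM u v : cls (u ++ v) = cls u * cls v. Proof. exact: cls_cat. Qed.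
Lemma clsS a w : cls (a :: w) = cls [:: a] * cls w.
Proof. by rewrite -clsM. Qed.

Lemma cls_ind (K : quotient -> Prop) :
  K 1 -> (forall a x, K x -> K (cls [:: a] * x)) -> forall x, K x.
Proof.
move=> K1 KS x; rewrite -[x]reprK; elim: (repr x) => [|a w IH] //.
by rewrite clsS; apply: KS.
Qed.

End Quotient.

Arguments cls {T P} w.

(** The inverse on words is part of the data, so one construction serves both reversal for
    involutive generators and the formal inverse of Artin words. *)
Record group_presentation (T : choiceType) := GroupPresentation {
  gpres :> presentation T;
  gflip : seq T -> seq T;
  gflipl : forall w, congr gpres (gflip w ++ w) [::];
  gflipr : forall w, congr gpres (w ++ gflip w) [::] }.

Definition gquotient (T : choiceType) (P : group_presentation T) := quotient P.

Section GroupQuotient.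
Variables (T : choiceType) (P : group_presentation T).
HB.instance Definition _ := Monoid.on (gquotient P).

Definition qinv (x : gquotient P) : gquotient P := cls (gflip P (repr x)).

HB.instance Definition _ := hasInv.Build (gquotient P) qinv.

Fact qmulV : left_inverse 1 qinv mul.
Proof.
by move=> x; rewrite -{2}[x]reprK -clsM; apply/clsP/gflipl.
Qed.

Fact qVmul : right_inverse 1 qinv mul.
Proof.
by move=> x; rewrite -{1}[x]reprK -clsM; apply/clsP/gflipr.
Qed.

HB.instance Definition _ := Monoid_isGroup.Build (gquotient P) qmulV qVmul.

End GroupQuotient.

(** * Meets from local joins *)

Section BoundedJoins.
Variables (T S : Type) (one : T) (op : S -> T -> T) (D : S -> T -> Prop).
Variables (len : T -> nat) (le : T -> T -> Prop).

(** Here [op s] models left multiplication by a generator and [D s] the elements where it adds a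
    letter: everything in the positive monoid, the elements without left descent [s] in the Coxeter
    group. *)
Definition starts s y := exists y', D s y' /\ y = op s y'.

Hypothesis le_refl : forall x, le x x.
Hypothesis le_trans : forall y x z, le x y -> le y z -> le x z.
Hypothesis one_le : forall x, le one x.
Hypothesis le_len : forall x y, le x y -> len x <= len y.
Hypothesis le_eq : forall x y, le x y -> len y <= len x -> x = y.
Hypothesis len_op : forall s x, D s x -> len (op s x) = (len x).+1.
Hypothesis op_cases : forall x, x = one \/ exists s, starts s x.
Hypothesis op_inj : forall s x y, D s x -> D s y -> op s x = op s y -> x = y.
Hypothesis le_op : forall s x y, D s x -> D s y -> le (op s x) (op s y) <-> le x y.
Hypothesis le_D : forall s x y, le x y -> D s y -> D s x.
Hypothesis le_starts : forall s x y, D s x -> le (op s x) y -> starts s y.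
Hypothesis local_join : forall s t, s = t \/
  exists p q, [/\ D s p, D t q, op s p = op t q &
               forall y, starts s y -> starts t y -> le (op s p) y].

Definition is_join a b l :=
  [/\ le a l, le b l & forall y, le a y -> le b y -> le l y].

(** Induction on the length of the upper bound [x]. For [a = s a'] and [b = t b'] the join of [s]
    and [t] lies below [x]; it is joined with [a] and with [b] below the shorter tails of [x], and
    the results are combined. *)
Lemma bounded_join x a b : le a x -> le b x -> exists l, is_join a b l.
Proof.
have [n] := ubnP (len x); elim: n x a b => // n IH x a b /ltnSE lx ax bx.
case: (op_cases a) => [->|[s [a' [Da Ea]]]]; first by exists b; split.
case: (op_cases b) => [->|[t [b' [Db Eb]]]]; first by exists a; split.
subst a b.
have [x1 [Dx1 Ex1]] := le_starts Da ax.
have [x2 [Dx2 Ex2]] := le_starts Db bx.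
have lx1 : len x1 < n by rewrite -ltnS -(len_op Dx1) -Ex1.
have lx2 : len x2 < n by rewrite -ltnS -(len_op Dx2) -Ex2.
have cons_join u c1 c2 y l : D u c1 -> D u c2 -> le c1 y -> le c2 y -> D u y ->
    is_join c1 c2 l -> [/\ is_join (op u c1) (op u c2) (op u l), D u l & le l y].
  move=> D1 D2 l1 l2 Dy [h1 h2 h3].
  have ly : le l y by exact: h3.
  have Dl : D u l by apply: le_D Dy.
  split=> //; split; [exact/le_op|exact/le_op|].
  move=> z k1 k2; have [z' [Dz Ez]] := le_starts D1 k1; subst z.
  by apply/le_op => //; apply: h3; [apply/(le_op D1 Dz)|apply/(le_op D2 Dz)].
case: (local_join s t) => [E|[p [q [Dp Dq Epq J]]]].
  subst t.
  have E : x1 = x2 by apply: (op_inj Dx1 Dx2); rewrite -Ex1.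
  subst x2.
  have h1 : le a' x1 by apply/(le_op Da Dx1); rewrite -Ex1.
  have h2 : le b' x1 by apply/(le_op Db Dx1); rewrite -Ex1.
  have [l hl] := IH _ _ _ lx1 h1 h2.
  by exists (op s l); have [] := cons_join s a' b' x1 l.
have jx : le (op s p) x by apply: J; [exists x1|exists x2].
have h1 : le a' x1 by apply/(le_op Da Dx1); rewrite -Ex1.
have h2 : le b' x2 by apply/(le_op Db Dx2); rewrite -Ex2.
have h3 : le p x1 by apply/(le_op Dp Dx1); rewrite -Ex1.
have h4 : le q x2 by apply/(le_op Dq Dx2); rewrite -Ex2 -Epq.
have [l1 hl1] := IH _ _ _ lx1 h1 h3.
have [l2 hl2] := IH _ _ _ lx2 h2 h4.
have [[A1 A2 A3] Dl1 l1x] := cons_join s a' p x1 l1 Da Dp h1 h3 Dx1 hl1.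
have [[B1 B2 B3] Dl2 l2x] := cons_join t b' q x2 l2 Db Dq h2 h4 Dx2 hl2.
(* [op t l2] lies above [op t q = op s p], so it begins with [s], and its tail can be joined with
   [l1] below [x1]. *)
have [l3 [Dl3 El3]] : starts s (op t l2).
  by apply: (le_starts Dp); rewrite Epq.
have l3x : le l3 x1.
  by apply/(le_op Dl3 Dx1); rewrite -Ex1 -El3 Ex2; apply/le_op.
have [l hl] := IH _ _ _ lx1 l1x l3x.
have [[C1 C2 C3] Dl lx'] := cons_join s l1 l3 x1 l Dl1 Dl3 l1x l3x Dx1 hl.
exists (op s l); split.
- exact: le_trans C1.
- by apply: le_trans C2; rewrite -El3.
move=> y ay by'.
have jy : le (op s p) y.
  by apply: J; [apply: (le_starts Da ay)|apply: (le_starts Db by')].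
apply: C3; first exact: A3.
by rewrite -El3; apply: B3; rewrite // -Epq.
Qed.

(** A longest common lower bound is the greatest: were another one not below it, their join, which
    exists below [x], would be a longer common lower bound. *)
Lemma meets x y :
  exists g, [/\ le g x, le g y & forall h, le h x -> le h y -> le h g].
Proof.
pose Q k := exists g, [/\ le g x, le g y & len x - len g = k].
have : exists k, Q k by exists (len x - len one), one.
case=> k; have [n] := ubnP k; elim: n k => // n IH k /ltnSE kn [g [gx gy gk]].
case: (excluded_middle_informative
   (exists h, [/\ le h x, le h y & ~ le h g])) => [[h [hx hy hg]]|N].
  have [l [gl hl lmin]] := bounded_join gx hx.
  have lx : le l x by exact: lmin.
  have ly : le l y by exact: lmin.
  apply: (IH (len x - len l)); last by exists l.
  have lt : len g < len l.
    rewrite ltnNge; apply/negP => k1; apply: hg.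
    by rewrite (le_eq gl k1).
  by have := le_len lx; have := le_len gx; lia.
exists g; split=> // h hx hy.
by case: (excluded_middle_informative (le h g)) => // k1; case: N; exists h.
Qed.

End BoundedJoins.

Lemma alt0 (S : finType) (s t : S) : alt s t 0 = [::]. Proof. by []. Qed.

(** * The geometric representation *)

Lemma altS (S : finType) (s t : S) k : alt s t k.+1 = s :: alt t s k.
Proof.
rewrite /alt /mkseq /=; congr cons.
rewrite -[iota _ _]/(iota (succn 0) k) (iotaDl (succn 0) 0) -map_comp.
by apply: eq_map => i /=; rewrite ?add1n; case: (odd i).
Qed.

Lemma size_alt (S : finType) (s t : S) k : size (alt s t k) = k.
Proof. exact: size_mkseq. Qed.

Section Geometric.
Local Open Scope R_scope.
Variables (S : finType) (m : S -> S -> nat).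
Hypothesis hm_sym : forall s t, m s t = m t s.
Hypothesis hm2 : forall s t, s != t -> (2 <= m s t)%N.

Definition angle s t := PI / INR (m s t).

Lemma INR_S k : INR k.+1 = INR k + 1. Proof. exact: S_INR. Qed.

Lemma INR_m s t : s != t -> 2 <= INR (m s t).
Proof. by move=> /hm2 /leP /le_INR. Qed.

Lemma angle_mul s t : s != t -> INR (m s t) * angle s t = PI.
Proof. by move=> /INR_m h; rewrite /angle; field; lra. Qed.

Lemma sin_angle_gt0 s t k : s != t -> (0 < k < m s t)%N ->
  0 < sin (INR k * angle s t).
Proof.
move=> st /andP[k0 km]; have h := INR_m st; have e := angle_mul st.
have P0 := PI_RGT_0.
have a0 : 0 < angle s t by apply: Rdiv_lt_0_compat; lra.
have k0' : 0 < INR k by apply: lt_0_INR; apply/ltP.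
have km' : INR k < INR (m s t) by apply: lt_INR; apply/ltP.
by apply: sin_gt_0; nra.
Qed.

(** Minus twice the bilinear form on simple roots; [fire s] is then the reflection [s] on linear
    forms, each given by its values on the simple roots. *)
Definition coef s t := if s == t then -2 else 2 * cos (angle s t).
Definition fire s (f : S -> R) : S -> R := fun u => f u + coef s u * f s.
Definition run (w : seq S) (f : S -> R) := foldl (fun f s => fire s f) f w.

Lemma run_cat u v f : run (u ++ v) f = run v (run u f).
Proof. exact: foldl_cat. Qed.

Lemma fire_self s f : fire s f s = - f s.
Proof. by rewrite /fire /coef eqxx; lra. Qed.

Lemma fire_sq s f : fire s (fire s f) = f.
Proof.
apply: functional_extensionality => u.
by rewrite {1}/fire fire_self /fire; lra.
Qed.

Section Dihedral.
Variables s t : S.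
Hypothesis st : s != t.
Let th := angle s t.

(* The value fired at step [k] when [s, t, s, ...] are fired from [(a, b)]. *)
Definition fired (a b : R) (k : nat) :=
  (a * sin (INR k.+1 * th) + b * sin (INR k * th)) / sin th.

Lemma sin_th_gt0 : 0 < sin th.
Proof.
have h : (0 < 1 < m s t)%N by rewrite hm2.
by have := sin_angle_gt0 st h; rewrite Rmult_1_l.
Qed.

Lemma sin_rec k : 2 * cos th * sin (INR k.+1 * th) =
  sin (INR k.+2 * th) + sin (INR k * th).
Proof.
rewrite (INR_S k.+1).
have -> : INR k = INR k.+1 - 1 by rewrite INR_S; lra.
rewrite Rmult_plus_distr_r Rmult_minus_distr_r Rmult_1_l.
by rewrite sin_plus sin_minus; lra.
Qed.

Lemma fired0 a b : fired a b 0 = a.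
Proof.
rewrite /fired Rmult_1_l Rmult_0_l sin_0; field.
by have := sin_th_gt0; lra.
Qed.

Lemma firedS a b k : fired (b + 2 * cos th * a) (- a) k = fired a b k.+1.
Proof.
rewrite /fired; congr (_ / _).
rewrite Rmult_plus_distr_r.
have -> : 2 * cos th * a * sin (INR k.+1 * th) =
  a * (2 * cos th * sin (INR k.+1 * th)) by lra.
by rewrite sin_rec; lra.
Qed.

End Dihedral.

Lemma fired_sym s t a b k : fired s t a b k = fired t s a b k.
Proof. by rewrite /fired /angle hm_sym. Qed.

(** [x] is the letter to be fired next and [y] the one just fired; one more firing is the recurrence
    for sines of multiples of the angle. *)
Lemma run_alt s t k f : s != t ->
  let x := if odd k then t else s in let y := if odd k then s else t in
  run (alt s t k) f x = fired s t (f s) (f t) k /\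
  (if k is k'.+1 then run (alt s t k) f y = - fired s t (f s) (f t) k' else True).
Proof.
elim: k s t f => [|k IH] s t f st; first by rewrite /= fired0.
rewrite altS /=; have ts : t != s by rewrite eq_sym.
have [] := IH t s (fire s f) ts.
have -> : fire s f t = f t + 2 * cos (angle s t) * f s.
  by rewrite /fire /coef (negPf st).
rewrite fire_self !(fired_sym t s) firedS.
case: k {IH} => [|k] /=; first by rewrite fire_self fired0.
rewrite negbK -/(run _ _) (fired_sym t s) firedS.
by case: (odd k) => /= h1 h2; rewrite h1 ?h2.
Qed.

(** The component of the root of [u] orthogonal to those of [s] and [t] is fixed by both
    reflections. The identity is multiplied by the determinant [4 - c * c] to avoid division. *)
Lemma run_alt_out s t u k f : s != t ->
  let c := 2 * cos (angle s t) in
  let p := 2 * coef s u + c * coef t u in let q := 2 * coef t u + c * coef s u in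
  (4 - c * c) * run (alt s t k) f u =
  (4 - c * c) * f u + p * (f s - run (alt s t k) f s)
                   + q * (f t - run (alt s t k) f t).
Proof.
elim: k s t f => [|k IH] s t f st; first by move=> /=; lra.
rewrite altS /= -/(run _ _); have ts : t != s by rewrite eq_sym.
have := IH t s (fire s f) ts; rewrite /= /angle (hm_sym t s) -/(angle s t).
rewrite fire_self => ->.
rewrite /fire /coef (negPf st).
set c := cos _.
by case: (s == u); case: (t == u); lra.
Qed.

(** [m s t] angles make a half turn, so either order negates the values at [s] and [t], exchanging
    them when [m s t] is odd. The conserved component then determines the value at every [u]. *)
Lemma run_braid s t f : s != t -> run (alt s t (m s t)) f = run (alt t s (m s t)) f.
Proof.
move=> st; have ts : t != s by rewrite eq_sym.
have s0 := sin_th_gt0 st.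
have := hm2 st; case Em : (m s t) => [|k] // _.
have Ek : INR k * angle s t = PI - angle s t.
  by rewrite -(angle_mul st) Em INR_S; lra.
have EM : INR k.+1 * angle s t = PI by rewrite -Em angle_mul.
have EM2 : INR k.+2 * angle s t = angle s t + PI by rewrite INR_S Rmult_plus_distr_r EM; lra.
have F a b : fired s t a b k.+1 = - a.
  by rewrite /fired EM EM2 neg_sin sin_PI; field; lra.
have G a b : fired s t a b k = b.
  rewrite /fired EM Ek sin_PI sin_minus sin_PI cos_PI; field; lra.
have [h1 h2] := @run_alt s t k.+1 f st.
have [h3 h4] := @run_alt t s k.+1 f ts.
rewrite /= !(fired_sym t s) !F !G in h1 h2 h3 h4.
have Es : run (alt s t k.+1) f s = run (alt t s k.+1) f s.
  by case: (odd k) h1 h2 h3 h4 => /= h1 h2 h3 h4; lra.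
have Et : run (alt s t k.+1) f t = run (alt t s k.+1) f t.
  by case: (odd k) h1 h2 h3 h4 => /= h1 h2 h3 h4; lra.
apply: functional_extensionality => u.
have := @run_alt_out s t u k.+1 f st.
have := @run_alt_out t s u k.+1 f ts.
lazy zeta; rewrite /angle (hm_sym t s) -/(angle s t) Es Et.
set c := cos _; have : 0 < 4 - 2 * c * (2 * c).
  by have := sin2_cos2 (angle s t); rewrite /Rsqr -/c; nra.
by move=> h k1 k2; apply: (Rmult_eq_reg_l (4 - 2 * c * (2 * c))); lra.
Qed.

Lemma run_congr u v : ceq m u v -> run u = run v.
Proof.
elim=> [{}u {}v h|//|? ? _ -> //|? ? ? _ -> _ -> //].
apply: functional_extensionality => f.
case: h => [x y s|x y s t st]; rewrite !run_cat /=.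
  by rewrite fire_sq.
by rewrite run_braid.
Qed.

(* From the all-positive configuration, after [0 < k < m] alternating firings
   the last letter fired carries a negative value and the other a positive one. *)
Lemma alt_neq s t k : s != t -> (0 < k < m s t)%N -> ~ ceq m (alt s t k) (alt t s k).
Proof.
move=> st /andP[k0 km] /run_congr E; have ts : t != s by rewrite eq_sym.
case: k k0 km E => // k _ km E.
have s0 := sin_th_gt0 st.
have F : 0 < fired s t 1 1 k.+1.
  apply: Rdiv_lt_0_compat => //.
  have h : (0 < k.+1 < m s t)%N by [].
  have := sin_angle_gt0 st h; set x := sin (INR k.+1 * _) => x0.
  case: (ltngtP k.+2 (m s t)) => h2; [|lia|].
    have h3 : (0 < k.+2 < m s t)%N by [].
    by have := sin_angle_gt0 st h3; lra.
  by rewrite h2 angle_mul // sin_PI; lra.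
have G : 0 < fired s t 1 1 k.
  apply: Rdiv_lt_0_compat => //.
  have h : (0 < k.+1 < m s t)%N by [].
  have := sin_angle_gt0 st h; set x := sin (INR k.+1 * _) => x0.
  case: k km {F E h} x x0 => [|k] km x x0; first by rewrite Rmult_0_l sin_0; lra.
  have h : (0 < k.+1 < m s t)%N by lia.
  by have := sin_angle_gt0 st h; lra.
pose f := fun _ : S => 1.
have [h1 h2] := @run_alt s t k.+1 f st.
have [h3 h4] := @run_alt t s k.+1 f ts.
rewrite !(fired_sym t s) /f in h1 h2 h3 h4; rewrite -E in h3 h4.
by move: h1 h2 h3 h4 => /=; case: (odd k) => /= h1 h2 h3 h4; lra.
Qed.

End Geometric.

(** * The Coxeter group and the exchange condition *)

Section CoxeterGroup.
Variables (S : finType) (m : S -> S -> nat).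

Fact cox_step_context x y u v :
  cox_step m u v -> cox_step m (x ++ u ++ y) (x ++ v ++ y).
Proof.
case=> [a b s|a b s t st].
  by have := cox_sq m (x ++ a) (b ++ y) s; rewrite !catA.
by have := cox_braid m (x ++ a) (b ++ y) st; rewrite -!catA.
Qed.

Definition cox_pres := Presentation (T := S) cox_step_context.

Lemma cox_sqP s : congr cox_pres [:: s; s] [::].
Proof. by apply: rst_step; have := cox_sq m [::] [::] s. Qed.

Lemma cox_revl w : congr cox_pres (rev w ++ w) [::].
Proof.
elim: w => [|s w IH]; first exact: rst_refl.
rewrite rev_cons cat_rcons; apply: rst_trans IH.
by have := congr_context (rev w) w (cox_sqP s).
Qed.

Lemma cox_revr w : congr cox_pres (w ++ rev w) [::].
Proof. by have := cox_revl (rev w); rewrite revK. Qed.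

Definition cox_group := GroupPresentation cox_revl cox_revr.
Definition W := gquotient cox_group.
HB.instance Definition _ := Group.on W.

Definition wc (w : seq S) : W := @cls _ cox_group w.
Definition gen (s : S) : W := wc [:: s].

Lemma wcP u v : wc u = wc v <-> ceq m u v. Proof. exact: clsP. Qed.
Lemma wcM u v : wc (u ++ v) = wc u * wc v. Proof. exact: clsM. Qed.
Lemma wcS s w : wc (s :: w) = gen s * wc w. Proof. exact: (wcM [:: s]). Qed.
Lemma wc0 : wc [::] = 1. Proof. by []. Qed.

Definition wmul (x y : W) : W := x * y.
Definition winv (x : W) : W := x^-1.

End CoxeterGroup.

(* The canonical instances on [W] reach [mul] along several paths, which are
   convertible but which [lia] does not identify. *)
Ltac glia :=
  intros;
  repeat match goal with
  | H : context [@mul ?M ?a ?b] |- _ => change (@mul M a b) with (wmul a b) in H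
  | H : context [@monoid.inv ?M ?a] |- _ => change (@monoid.inv M a) with (winv a) in H
  | |- context [@mul ?M ?a ?b] => change (@mul M a b) with (wmul a b)
  | |- context [@monoid.inv ?M ?a] => change (@monoid.inv M a) with (winv a)
  end; lia.

(** * Length, reflections and the prefix order in the Coxeter group *)

Section CoxeterLength.
Variables (S : finType) (m : S -> S -> nat).
Notation W := (W m).
Notation wc := (@wc S m).
Notation gen := (@gen S m).

Lemma gensq s : gen s * gen s = 1.
Proof. by rewrite -wcM; apply/wcP/cox_sqP. Qed.

Lemma genV s : (gen s)^-1 = gen s.
Proof. by apply: mulg1_eq; apply: gensq. Qed.

Lemma genK s : cancel (mul (gen s)) (mul (gen s)).
Proof. by move=> x; rewrite mulgA gensq mul1g. Qed.

Lemma wcV w : (wc w)^-1 = wc (rev w).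
Proof.
apply: mulg1_eq; elim: w => [|s w IH]; first by rewrite mulg1.
by rewrite rev_cons -cats1 wcM wcS mulgA -(mulgA (gen s)) IH mulg1 gensq.
Qed.

Lemma braidW s t : s != t -> wc (alt s t (m s t)) = wc (alt t s (m s t)).
Proof.
move=> st; apply/wcP/rst_step.
by have := cox_braid m [::] [::] st; rewrite !cats0.
Qed.

Lemma ex_reduced (x : W) :
  exists v, wc v = x /\ forall u, wc u = x -> size v <= size u.
Proof.
have : exists v, wc v = x by exists (repr x); apply: reprK.
case=> v; have [n] := ubnP (size v); elim: n v => // n IH v /ltnSE vn vx.
case: (excluded_middle_informative
   (exists2 u, wc u = x & size u < size v)) => [[u ux uv]|N].
  by apply: (IH u) => //; lia.
by exists v; split=> // u ux; rewrite leqNgt; apply/negP => uv; case: N; exists u.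
Qed.

Definition rw (x : W) : seq S := sval (constructive_indefinite_description _ (ex_reduced x)).
Definition len (x : W) := size (rw x).

Lemma rwK x : wc (rw x) = x.
Proof. by rewrite /rw; case: constructive_indefinite_description => v []. Qed.

Lemma len_min w : len (wc w) <= size w.
Proof.
rewrite /len /rw; case: constructive_indefinite_description => v /= [_]; exact.
Qed.

Definition reduced w := len (wc w) == size w.

Lemma reducedP w : reflect (forall v, wc v = wc w -> size w <= size v) (reduced w).
Proof.
apply: (iffP idP) => [/eqP <- v <-|h]; first exact: len_min.
by rewrite /reduced eqn_leq len_min /len h // rwK.
Qed.

Lemma rw_reduced x : reduced (rw x).
Proof. by rewrite /reduced rwK. Qed.

Lemma len1 : len 1 = 0.
Proof. by apply/eqP; rewrite -leqn0; have := len_min [::]; rewrite wc0. Qed.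

Lemma len_eq0 x : len x = 0 -> x = 1.
Proof. by move=> /size0nil h; rewrite -(rwK x) h. Qed.

Lemma lenM x y : len (x * y) <= len x + len y.
Proof. by rewrite -{1}(rwK x) -{1}(rwK y) -wcM -size_cat len_min. Qed.

Lemma lenV_le x : len x^-1 <= len x.
Proof. by rewrite -{1}(rwK x) wcV (leq_trans (len_min _)) // size_rev. Qed.

Lemma lenV x : len x^-1 = len x.
Proof.
by apply/eqP; rewrite eqn_leq lenV_le /=; have := lenV_le x^-1; rewrite invgK.
Qed.

Lemma len_gen_le s : len (gen s) <= 1. Proof. exact: (len_min [:: s]). Qed.

Lemma odd_congr u v : ceq m u v -> odd (size u) = odd (size v).
Proof.
elim=> [{}u {}v h|//|? ? _ -> //|? ? ? _ -> _ -> //].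
case: h => [x y s|x y s t st]; rewrite !size_cat ?size_alt //= !oddD /=.
by [].
Qed.

Lemma odd_len w : odd (len (wc w)) = odd (size w).
Proof. by apply: odd_congr; apply/wcP; rewrite rwK. Qed.

Lemma odd_lenM x y : odd (len (x * y)) = odd (len x) (+) odd (len y).
Proof. by rewrite -{1}(rwK x) -{1}(rwK y) -wcM odd_len size_cat oddD. Qed.

Lemma len_gen s : len (gen s) = 1%N.
Proof.
have := odd_len [:: s]; rewrite -/(gen s) /=; have := len_gen_le s.
by case: (len (gen s)) => [|[]].
Qed.

Lemma len_genM s x : len (gen s * x) = (len x).+1 \/ (len (gen s * x)).+1 = len x.
Proof.
have h1 := lenM (gen s) x; have h2 := lenM (gen s) (gen s * x).
rewrite genK in h2; rewrite len_gen in h1 h2.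
have := odd_lenM (gen s) x; rewrite len_gen /= => h3.
have : len (gen s * x) != len x.
  by apply/eqP => E; move: h3; rewrite E; case: (odd _).
by move=> /eqP; glia.
Qed.

(* Parity of the number of occurrences of [r] among the reflections
   [s_1 ... s_i ... s_1] attached to the word [s_1 s_2 ...]. *)
Fixpoint par (w : seq S) (r : W) : bool :=
  if w is s :: w' then (r == gen s) (+) par w' (gen s * r * gen s) else false.

Lemma par_cat u v r : par (u ++ v) r = par u r (+) par v ((wc u)^-1 * r * wc u).
Proof.
elim: u r => [|s u IH] r /=; first by rewrite wc0 invg1 mul1g mulg1.
by rewrite IH wcS invgM genV !mulgA addbA.
Qed.

Lemma expg_swap (G : groupType) (x y : G) k : x * (y * x) ^+ k * y = (x * y) ^+ k.+1.
Proof.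
elim: k => [|k IH]; first by rewrite expg0 mulg1 expg1.
by rewrite expgSr !mulgA IH [RHS]expgSr !mulgA.
Qed.

Lemma alt_quot s t k : wc (alt s t k) * (wc (alt t s k))^-1 = (gen s * gen t) ^+ k.
Proof.
elim: k s t => [|k IH] s t; first by rewrite expg0 wc0 invg1 mulg1.
rewrite !altS !wcS invgM genV !mulgA -(mulgA _ _ (wc (alt s t k))^-1) IH.
exact: expg_swap.
Qed.

Lemma par_alt s t k r :
  par (alt s t k) r = \big[addb/false]_(i < k) (r == (gen s * gen t) ^+ i * gen s).
Proof.
elim: k s t r => [|k IH] s t r; first by rewrite big_ord0.
rewrite altS /= IH big_ord_recl expg0 mul1g; congr addb.
apply: eq_bigr => i _ /=; rewrite -(inj_eq (mulgI (gen s))) -(inj_eq (mulIg (gen s))).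
rewrite -[_ ^+ i.+1 in RHS]expg_swap /=.
by rewrite -!mulgA gensq mulg1 !mulgA gensq mul1g.
Qed.

(** As [(st)^m = 1], the two alternating words list the same [m] reflections in opposite orders. *)
Lemma par_braid s t r : s != t -> par (alt s t (m s t)) r = par (alt t s (m s t)) r.
Proof.
move=> st; rewrite !par_alt (reindex_inj rev_ord_inj) /=.
apply: eq_bigr => i _; congr (_ == _).
have E : (gen s * gen t) ^+ m s t = 1 by rewrite -alt_quot braidW // mulgV.
have V : (gen t * gen s) = (gen s * gen t)^-1 by rewrite invgM !genV.
apply: (mulgI ((gen s * gen t) ^+ i.+1)); rewrite !mulgA -expgnDr.
have -> : (i.+1 + (m s t - i.+1))%N = m s t by have := ltn_ord i; glia.
by rewrite E mul1g V expVgn expgS -(mulgA _ _ (_ ^- i)) mulgV mulg1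
  -mulgA gensq mulg1.
Qed.

Lemma par_congr u v : ceq m u v -> par u = par v.
Proof.
elim=> [{}u {}v h|//|? ? _ -> //|? ? ? _ -> _ -> //].
apply: functional_extensionality => r.
case: h => [x y s|x y s t st]; rewrite !par_cat; congr addb.
  move: (_ * wc x) => q.
  have -> : wc [:: s; s] = 1 by rewrite wcS gensq.
  have -> : par [:: s; s] q = false.
    rewrite /=.
    have -> : (gen s * q * gen s == gen s) = (q == gen s).
      apply/eqP/eqP => [h|->]; last by rewrite gensq mul1g.
      by rewrite -(genK s q) -(mulgK (gen s) (_ * q)) h genV gensq mulg1.
    by rewrite addbF addbb.
  by rewrite invg1 mul1g mulg1.
by rewrite braidW // par_braid.
Qed.

(** An odd count means that [r] occurs in the list, and multiplying by the reflection attached to a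
    letter deletes that letter. *)
Lemma par_delete w r : par w r ->
  exists2 w', size w' < size w & r * wc w = wc w'.
Proof.
elim: w r => [|s w IH] r //=; case: eqP => [->|_] /=.
  by exists w => //; rewrite wcS genK.
move=> /IH[w' lt E]; exists (s :: w'); first by [].
by rewrite !wcS -E !mulgA gensq mul1g.
Qed.

Definition desc s x := len (gen s * x) < len x.

(** The parity may be computed on [s :: v] with [v] reduced for [gen s * wc w]. The first letter
    contributes one; the rest contributes an even number, since a deletion in [v] would give too
    short a word for [wc w]. *)
Lemma desc_par s w : desc s (wc w) -> par w (gen s).
Proof.
rewrite /desc => h; set v := rw (gen s * wc w).
have E : wc w = wc (s :: v) by rewrite wcS rwK genK.
rewrite (par_congr (proj1 (wcP _ _ _) E)) /= eqxx gensq mul1g /=.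
apply/negP => /par_delete[v' lt]; rewrite rwK genK => E'.
by have := len_min v'; rewrite -E'; move: h lt; rewrite /v -/(len _); glia.
Qed.

(** The prefix order: [x] begins some reduced word of [y]. *)
Definition wle (x y : W) := len y == len x + len (x^-1 * y).

Lemma wle_len x y : wle x y -> len x <= len y.
Proof. by move=> /eqP ->; apply: leq_addr. Qed.

Lemma wle_cat x y : wle x (x * y) = (len (x * y) == len x + len y).
Proof. by rewrite /wle mulKg. Qed.

Lemma wle_refl x : wle x x.
Proof. by rewrite /wle mulVg len1 addn0. Qed.

Lemma wle1 x : wle 1 x.
Proof. by rewrite /wle invg1 mul1g len1. Qed.

Lemma len_div x y : len y <= len x + len (x^-1 * y).
Proof. by rewrite -{1}[y](mulVKg x) lenM. Qed.

Lemma len_quot y x z : len (x^-1 * z) <= len (x^-1 * y) + len (y^-1 * z).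
Proof. by rewrite -{1}[z](mulVKg y) mulgA lenM. Qed.

Lemma wle_trans y x z : wle x y -> wle y z -> wle x z.
Proof.
move=> /eqP h1 /eqP h2; apply/eqP.
have := len_quot y x z; have := len_div x z; glia.
Qed.

Lemma wle_eq x y : wle x y -> len y <= len x -> x = y.
Proof.
move=> /eqP h1 h2; have : len (x^-1 * y) = 0 by glia.
by move=> /len_eq0 h; rewrite -[y](mulVKg x) h mulg1.
Qed.

Lemma wle_gen s x : desc s x = wle (gen s) x.
Proof.
by rewrite /desc /wle genV len_gen; case: (len_genM s x) => ?; apply/idP/eqP; glia.
Qed.

Lemma ndesc s x : ~~ desc s x -> len (gen s * x) = (len x).+1.
Proof. by rewrite /desc; case: (len_genM s x); glia. Qed.

(* The exchange condition: the letter deleted from a reduced word of [x] by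
   [s] cannot lie in its prefix [a]. *)
Lemma wle_lift s a x : wle a x -> desc s x -> ~~ desc s a -> wle (gen s * a) x.
Proof.
move=> /eqP ax sx sa.
have E : x = wc (rw a ++ rw (a^-1 * x)) by rewrite wcM !rwK mulVKg.
have : desc s (wc (rw a ++ rw (a^-1 * x))) by rewrite -E.
move=> /desc_par; rewrite par_cat rwK.
case: (boolP (par (rw a) (gen s))) => [/par_delete[w lt]|_].
  rewrite rwK => Ew; case/negP: sa; rewrite /desc Ew.
  by apply: leq_ltn_trans (len_min _) lt.
move=> /= /par_delete[w lt]; rewrite rwK -/(len _) in lt *.
move=> Ew; have E2 : (gen s * a)^-1 * x = wc w.
  by rewrite -Ew invgM genV -!mulgA mulVKg.
rewrite /wle E2 (ndesc sa); apply/eqP.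
have h1 := len_min w; have := len_div (gen s * a) x.
rewrite E2 (ndesc sa); move: ax h1 lt; rewrite -/(len _); glia.
Qed.

End CoxeterLength.

(** * The Artin group *)

Section ArtinGroup.
Variables (S : finType) (m : S -> S -> nat).

Fact art_step_context x y u v :
  art_step m u v -> art_step m (x ++ u ++ y) (x ++ v ++ y).
Proof.
case=> [a b s c|a b s t st].
  by have := art_cancel m (x ++ a) (b ++ y) s c; rewrite !catA.
by have := art_braid m (x ++ a) (b ++ y) st; rewrite -!catA.
Qed.

Definition art_pres := Presentation (T := letter S) art_step_context.

Lemma art_cancelP s b : congr art_pres [:: (s, b); (s, ~~ b)] [::].
Proof. by apply: rst_step; have := art_cancel m [::] [::] s b. Qed.

Lemma inv_cons (l : letter S) w : inv (l :: w) = rcons (inv w) (l.1, ~~ l.2).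
Proof. by rewrite /inv /= rev_cons. Qed.

Lemma invK : involutive (@inv S).
Proof.
move=> w; rewrite /inv map_rev revK -map_comp map_id_in // => -[s b] _ /=.
by rewrite negbK.
Qed.

Lemma art_invr w : congr art_pres (w ++ inv w) [::].
Proof.
elim: w => [|[s b] w IH]; first exact: rst_refl.
rewrite inv_cons -cats1 catA; apply: rst_trans (art_cancelP s b).
by have := congr_context [:: (s, b)] [:: (s, ~~ b)] IH.
Qed.

Lemma art_invl w : congr art_pres (inv w ++ w) [::].
Proof. by have := art_invr (inv w); rewrite invK. Qed.

Definition art_group := GroupPresentation art_invl art_invr.
Definition A := gquotient art_group.
HB.instance Definition _ := Group.on A.

Definition ac (w : seq (letter S)) : A := @cls _ art_group w.

Lemma acP u v : ac u = ac v <-> aeq m u v. Proof. exact: clsP. Qed.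
Lemma acM u v : ac (u ++ v) = ac u * ac v. Proof. exact: clsM. Qed.
Lemma ac0 : ac [::] = 1. Proof. by []. Qed.
Lemma acK (a : A) : ac (repr a) = a. Proof. exact: reprK. Qed.

Lemma acV w : ac (inv w) = (ac w)^-1.
Proof.
by apply/esym/mulg1_eq; rewrite -acM -ac0; apply/acP/art_invr.
Qed.

Lemma acX w n : ac (wpow w n) = ac w ^+ n.
Proof.
elim: n => [|n IH]; first by rewrite expg0.
by rewrite expgS -IH -acM.
Qed.

Lemma acN s : ac [:: (s, false)] = (ac [:: (s, true)])^-1.
Proof. by rewrite -acV. Qed.

Definition weight (w : seq (letter S)) : Z :=
  foldr (fun l z => (z + if l.2 then 1 else -1)%Z) 0%Z w.

Lemma weight_cons l w : weight (l :: w) = (weight w + if l.2 then 1 else -1)%Z.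
Proof. by []. Qed.

Lemma weight_cat u v : weight (u ++ v) = (weight u + weight v)%Z.
Proof. by elim: u => [|l u IH] //; rewrite cat_cons !weight_cons IH; lia. Qed.

Lemma weight_pos w : weight (pos w) = Z.of_nat (size w).
Proof.
elim: w => [|s w IH] //; rewrite -[pos _]/((s, true) :: pos w) weight_cons IH.
change (Z.of_nat (size w) + 1 = Z.of_nat (size w).+1)%Z; lia.
Qed.

Lemma weight_congr u v : congr art_pres u v -> weight u = weight v.
Proof.
elim=> [{}u {}v h|//|? ? _ -> //|? ? ? _ -> _ -> //].
case: h => [x y s b|x y s t st]; rewrite !weight_cat; first by rewrite !weight_cons; case: b => /=; lia.
by rewrite !(weight_pos (alt _ _ _)) !size_alt.
Qed.

Definition exps (a : A) : Z := weight (repr a).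

Lemma exps_ac w : exps (ac w) = weight w.
Proof. exact/weight_congr/repr_cls. Qed.

Lemma expsM a b : exps (a * b) = (exps a + exps b)%Z.
Proof. by rewrite -{1}(acK a) -{1}(acK b) -acM exps_ac weight_cat. Qed.

Lemma exps1 : exps 1 = 0%Z. Proof. by rewrite -ac0 exps_ac. Qed.

Lemma expsV a : exps a^-1 = (- exps a)%Z.
Proof.
apply/(Z.add_cancel_l _ _ (exps a)); rewrite -expsM mulgV exps1; lia.
Qed.

Lemma expsX a n : exps (a ^+ n) = (Z.of_nat n * exps a)%Z.
Proof.
elim: n => [|n IH]; first by rewrite expg0 exps1.
by rewrite expgS expsM IH; lia.
Qed.

End ArtinGroup.

(** * The weak order and the positive monoid *)

Section FiniteType.
Variables (S : finType) (m : S -> S -> nat).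
Hypothesis hm_sym : forall s t, m s t = m t s.
Hypothesis hm2 : forall s t, s != t -> 1 < m s t.
Notation W := (W m).
Notation wc := (@wc S m).
Notation gen := (@gen S m).

Lemma alt_neqW s t k : s != t -> 0 < k < m s t -> wc (alt s t k) <> wc (alt t s k).
Proof. by move=> st hk /wcP; apply: alt_neq. Qed.

Lemma gen_inj : injective gen.
Proof.
move=> s t E; apply/eqP/idPn => st.
by apply: (@alt_neqW s t 1) => //; rewrite hm2.
Qed.

(** If putting [s] in front shortened the word, [s] would be one of its reflections [(ts)^i t], and
    the two alternating words of length [i + 1 < m] would agree, against the geometric
    representation. *)
Lemma len_alt s t k : s != t -> k <= m s t -> len (wc (alt s t k)) = k.
Proof.
elim: k s t => [|k IH] s t st km; first by rewrite alt0 wc0 len1.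
have ts : t != s by rewrite eq_sym.
rewrite altS wcS ndesc ?IH // ?(ltnW km) 1?hm_sym ?(ltnW km) //.
apply/negP => /desc_par; rewrite par_alt => h.
have [i /eqP E] : exists i : 'I_k, gen s == (gen t * gen s) ^+ i * gen t.
  apply/existsP; move: h; apply: contraTT => /existsPn h.
  by rewrite big1 // => i _; apply/negbTE/h.
have ik := ltn_ord i.
apply: (@alt_neqW t s i.+1 ts); first by rewrite hm_sym; lia.
apply: divg1_eq; rewrite alt_quot expgSr mulgA -E.
exact: gensq.
Qed.

Lemma ndesc_alt s t k : s != t -> k < m s t -> ~~ desc s (wc (alt t s k)).
Proof.
move=> st km; have ts : t != s by rewrite eq_sym.
by rewrite /desc -wcS -altS !len_alt // 1?hm_sym //; lia.
Qed.

Lemma reduced_alt s t : s != t -> reduced m (alt s t (m s t)).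
Proof. by move=> st; rewrite /reduced len_alt // size_alt. Qed.

(** Both alternating words grow together: each is the other one with a descent of [x] put in front,
    so the exchange condition keeps it below [x]. *)
Lemma wle_alt s t x : s != t -> desc s x -> desc t x ->
  wle (wc (alt s t (m s t))) x.
Proof.
move=> st sx tx.
suff h k : k <= m s t -> wle (wc (alt s t k)) x /\ wle (wc (alt t s k)) x.
  by have [] := h _ (leqnn _).
elim: k => [|k IH] km; first by rewrite !alt0 wc0 !wle1.
have [h1 h2] := IH (ltnW km); have ts : t != s by rewrite eq_sym.
rewrite !altS !wcS; split; apply: wle_lift => //; apply: ndesc_alt => //.
by rewrite hm_sym.
Qed.

Lemma wle_mul (v x y : W) : len (v * x) = len v + len x -> len (v * y) = len v + len y ->
  wle (v * x) (v * y) = wle x y.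
Proof.
move=> h1 h2; rewrite /wle h1 h2.
have -> : (v * x)^-1 * (v * y) = x^-1 * y by rewrite invgM -mulgA mulKg.
by rewrite -addnA eqn_add2l.
Qed.

Lemma desc_starts s x :
  starts (fun s x => gen s * x) (fun s x => ~~ desc s x) s x <-> desc s x.
Proof.
split=> [[y [Dy ->]]|h]; first by rewrite /desc genK ndesc.
exists (gen s * x); rewrite genK; split=> //.
by rewrite /desc genK -leqNgt ltnW.
Qed.

Lemma weak_meets (x y : W) :
  exists g, [/\ wle g x, wle g y & forall h, wle h x -> wle h y -> wle h g].
Proof.
have lenD s (z : W) : ~~ desc s z -> len (gen s * z) = len (gen s) + len z.
  by move=> /ndesc ->; rewrite len_gen.
apply: (@meets W S 1 (fun s x => gen s * x) (fun s x => ~~ desc s x)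
         (@len S m) (@wle S m)).
- exact: wle_refl.
- exact: wle_trans.
- exact: wle1.
- exact: wle_len.
- exact: wle_eq.
- by move=> s z; apply: ndesc.
- move=> z; case E : (rw z) => [|s w]; [left|right].
    by rewrite -(rwK z) E.
  exists s; apply/desc_starts; rewrite /desc -(rwK z) E wcS genK.
  apply: leq_ltn_trans (len_min _ _) _.
  by rewrite -wcS -E rwK /len E.
- by move=> s z t _ _ /mulgI.
- by move=> s z t h1 h2; rewrite wle_mul //; apply: lenD.
- move=> s z t zt; rewrite !wle_gen; apply: contra => h.
  exact: wle_trans zt.
- move=> s z t Dz h; apply/desc_starts; rewrite wle_gen; apply: wle_trans h.
  by rewrite wle_cat lenD.
move=> s t; case: (eqVneq s t) => [->|st]; [by left|right].
have ts : t != s by rewrite eq_sym.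
have := hm2 st; case Em : (m s t) => [|k] // _.
(* The local join is the alternating word of length [m]; the witnesses are its two forms without
   their first letters. *)
exists (wc (alt t s k)), (wc (alt s t k)); rewrite -!wcS -!altS -Em.
have D1 : ~~ desc s (wc (alt t s k)).
  by apply: ndesc_alt; rewrite // Em.
have D2 : ~~ desc t (wc (alt s t k)).
  by apply: ndesc_alt; rewrite // hm_sym Em.
split=> //; first by rewrite braidW.
by move=> z /desc_starts h1 /desc_starts h2; apply: wle_alt.
Qed.

Definition wmeet x y := sval (constructive_indefinite_description _ (weak_meets x y)).

Lemma wmeetP x y : [/\ wle (wmeet x y) x, wle (wmeet x y) y &
  forall h, wle h x -> wle h y -> wle h (wmeet x y)].
Proof. by rewrite /wmeet; case: constructive_indefinite_description. Qed.

(** * The positive monoid and Matsumoto's theorem *)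

Inductive braid_step : seq S -> seq S -> Prop :=
| BraidStep x y s t : s != t ->
    braid_step (x ++ alt s t (m s t) ++ y) (x ++ alt t s (m s t) ++ y).

Fact braid_step_context x y u v :
  braid_step u v -> braid_step (x ++ u ++ y) (x ++ v ++ y).
Proof.
by case=> a b s t st; have := BraidStep (x ++ a) (b ++ y) st; rewrite -!catA.
Qed.

Definition braid_pres := Presentation (T := S) braid_step_context.
Definition M := quotient braid_pres.
HB.instance Definition _ := Monoid.on M.

Definition mc (w : seq S) : M := @cls _ braid_pres w.

Lemma mcM u v : mc (u ++ v) = mc u * mc v. Proof. exact: clsM. Qed.
Lemma mcS s w : mc (s :: w) = mc [:: s] * mc w. Proof. exact: (mcM [:: s]). Qed.
Lemma mcP u v : mc u = mc v <-> congr braid_pres u v. Proof. exact: clsP. Qed.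
Lemma mc_repr (x : M) : mc (repr x) = x. Proof. exact: reprK. Qed.

Lemma braidM s t : s != t -> mc (alt s t (m s t)) = mc (alt t s (m s t)).
Proof.
move=> st; apply/mcP/rst_step.
by have := BraidStep [::] [::] st; rewrite !cats0.
Qed.

Lemma reduced_cons s w : reduced m (s :: w) -> reduced m w /\ ~~ desc s (wc w).
Proof.
rewrite /reduced wcS /= => /eqP h; have := lenM (gen s) (wc w).
have := len_min m w; rewrite h len_gen => h1 h2.
have h3 : len (wc w) = size w by lia.
by split; [apply/eqP|rewrite /desc h h3 -leqNgt].
Qed.

(** With equal first letters the tails are compared. Otherwise both letters are descents, so the
    element is an alternating word of length [m] followed by [w]; each word equals the form of this
    product with its own first letter, and a braid relation connects the two forms. *)
Lemma matsumoto u v : reduced m u -> reduced m v -> wc u = wc v -> mc u = mc v.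
Proof.
have [n] := ubnP (size u); elim: n u v => // n IH u v /ltnSE un ru rv E.
have sz : size u = size v by rewrite -(eqP ru) -(eqP rv) E.
case: u v sz un ru rv E => [|s u] [|t v] //= [sz] un ru rv E.
have [ru' su] := reduced_cons ru; have [rv' tv] := reduced_cons rv.
case: (eqVneq s t) E => [<-|st] E.
  rewrite (mcS s u) (mcS s v); congr mul; apply: IH => //.
  by apply: (mulgI (gen s)); rewrite -!wcS.
have ts : t != s by rewrite eq_sym.
have sx : desc s (wc (s :: u)) by rewrite wcS /desc genK ndesc.
have tx : desc t (wc (s :: u)) by rewrite E wcS /desc genK ndesc.
have := wle_alt st sx tx; set a := wc (alt _ _ _) => /eqP ax.
set w := rw (a^-1 * wc (s :: u)).
have Ew : wc (s :: u) = a * wc w by rewrite rwK mulVKg.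
have szw : (m s t + size w)%N = (size u).+1.
  by rewrite -[RHS](eqP ru) ax len_alt.
have := hm2 st; case Em : (m s t) => [|k] // _.
have main s' t' u' : s' != t' -> m s' t' = k.+1 -> reduced m (s' :: u') ->
   size u' = size u -> wc (s' :: u') = wc (alt s' t' k.+1) * wc w ->
   mc (s' :: u') = mc (alt s' t' k.+1 ++ w).
  move=> st' Em' ru2 szu Eu; rewrite altS cat_cons (mcS s' u') (mcS s' (_ ++ _)); congr mul.
  have Ew' : wc u' = wc (alt t' s' k ++ w).
    by apply: (mulgI (gen s')); rewrite -wcS Eu wcM mulgA -wcS -altS.
  have [ru3 _] := reduced_cons ru2.
  apply: IH => //; first by rewrite szu.
  rewrite /reduced -Ew' (eqP ru3) size_cat size_alt szu; apply/eqP.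
  by move: szw; rewrite Em addSn => -[].
rewrite (main s t u) //; last by rewrite -Em.
rewrite (main t s v) //; last by rewrite -E Ew /a braidW // Em.
  by rewrite !mcM -Em braidM.
by rewrite hm_sym.
Qed.

Definition lift (x : W) : M := mc (rw x).

Lemma lift_reduced w : reduced m w -> lift (wc w) = mc w.
Proof. by move=> h; apply: matsumoto => //; [apply: rw_reduced|rewrite rwK]. Qed.

Lemma liftM x y : len (x * y) = len x + len y -> lift (x * y) = lift x * lift y.
Proof.
move=> h; rewrite -mcM -lift_reduced ?wcM ?rwK //.
by rewrite /reduced wcM !rwK size_cat; apply/eqP.
Qed.

Lemma lift1 : lift 1 = 1.
Proof. by rewrite /lift (size0nil (len1 m)). Qed.

Lemma lift_gen s : lift (gen s) = mc [:: s].
Proof. by apply: lift_reduced; rewrite /reduced [len _]len_gen. Qed.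

Lemma lift_le x y : wle x y -> lift y = lift x * lift (x^-1 * y).
Proof. by move=> /eqP h; rewrite -liftM mulVKg. Qed.

(** * Normal forms *)

Section Longest.
Variable w0 : W.
Hypothesis w0_max : forall x : W, len x <= len w0.

Lemma desc_w0 s : desc s w0.
Proof. by apply/negPn/negP => /ndesc h; have := w0_max (gen s * w0); rewrite h ltnn. Qed.

(** A reduced word is built from its end; every generator is a descent of [w0], so the exchange
    condition keeps each suffix below [w0]. *)
Lemma wle_w0 x : wle x w0.
Proof.
rewrite -(rwK x); have := rw_reduced x; elim: (rw x) => [|s w IH] h.
  exact: wle1.
have [h1 h2] := reduced_cons h; rewrite wcS; apply: wle_lift => //.
  exact: IH.
exact: desc_w0.
Qed.

Lemma len_w0 x : len w0 = len x + len (x^-1 * w0).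
Proof. exact/eqP/wle_w0. Qed.

(** The lengths of an element and of its complement in [w0] add up to [len w0], so both sides
    compare the complements of [u] and [u * z]. *)
Lemma additive_le u z : (len (u * z) = len u + len z) <-> wle z (u^-1 * w0).
Proof.
have h1 := len_w0 u; have h2 := len_w0 (u * z).
have E : (u * z)^-1 * w0 = z^-1 * (u^-1 * w0) by rewrite invgM mulgA.
rewrite /wle; rewrite E in h2; split=> [h|/eqP]; first by apply/eqP; glia.
by glia.
Qed.

(** [z] is the largest prefix of [A] with [u * z] still length-additive; the rest of [A] is pushed
    into the tail. Arbitrary sequences are allowed, so the action laws are proved without an
    invariant. *)
Fixpoint act (u : W) (L : seq W) : seq W :=
  if L is A :: L' then let z := wmeet A (u^-1 * w0) in u * z :: act (z^-1 * A) L'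
  else if u == 1 then [::] else [:: u].

Lemma act_mul u v L : len (u * v) = len u + len v -> act (u * v) L = act u (act v L).
Proof.
elim: L u v => [|A L IH] u v huv /=.
  case: (eqVneq v 1) => [->|v1] /=; first by rewrite mulg1.
  case: (eqVneq (u * v) 1) => [h|_] /=.
    have v0 : len v = 0 by move: huv; rewrite h len1; lia.
    by rewrite (len_eq0 v0) eqxx in v1.
  have [h1 h2 h3] := wmeetP v (u^-1 * w0).
  have -> : wmeet v (u^-1 * w0) = v.
    apply: wle_eq => //; apply/wle_len/h3; first exact: wle_refl.
    exact/additive_le.
  by rewrite mulVg eqxx.
have [a1 a2 a3] := wmeetP A ((u * v)^-1 * w0).
have [b1 b2 b3] := wmeetP A (v^-1 * w0).
set z := wmeet A _ in a1 a2 a3 *; set z1 := wmeet A _ in b1 b2 b3 *.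
have [c1 c2 c3] := wmeetP (v * z1) (u^-1 * w0).
set z3 := wmeet (v * z1) _ in c1 c2 c3 *.
have v1 : len (v * z1) = len v + len z1 by apply/additive_le.
have vz3 : wle v z3.
  by apply: c3; [rewrite wle_cat v1|apply/additive_le].
have [z2 Ez] : exists z2, z3 = v * z2 by exists (v^-1 * z3); rewrite mulVKg.
have v2 : len (v * z2) = len v + len z2.
  by apply/eqP; rewrite -wle_cat -Ez.
have u2 : len (u * (v * z2)) = len u + len (v * z2).
  by apply/additive_le; rewrite -Ez.
have z21 : wle z2 z1 by rewrite -(wle_mul v2 v1) -Ez.
(* What [u * v] draws from [A] is the part [z2] of [z1] that stays once [u] is multiplied in: each
   of [z] and [z2] satisfies the conditions under which the other is maximal. *)
have zz : z = z2.
  have uvz : len (u * v * z) = len (u * v) + len z by apply/additive_le.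
  have Euvz : len (u * (v * z)) = len (u * v * z) by rewrite mulgA.
  have t1 := lenM v z; have t2 := lenM u (v * z).
  have vz : len (v * z) = len v + len z by glia.
  have uvz' : len (u * (v * z)) = len u + len (v * z) by glia.
  have zz1 : wle z z1 by apply: b3 => //; apply/additive_le.
  apply: wle_eq.
    rewrite -(wle_mul vz v2) -Ez; apply: c3; first by rewrite wle_mul.
    exact/additive_le.
  apply/wle_len/a3; first exact: wle_trans b1.
  apply/additive_le.
  have -> : len (u * v * z2) = len (u * (v * z2)) by rewrite mulgA.
  by glia.
rewrite zz Ez; congr cons; first by rewrite mulgA.
(* The two elements pushed into the tail, [z1^-1 * A] and then [z2^-1 * z1], have the product
   [z2^-1 * A] with lengths adding up. *)
rewrite -IH; last first.
  have -> : (v * z2)^-1 * (v * z1) = z2^-1 * z1 by rewrite invgM -mulgA mulKg.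
  have -> : z2^-1 * z1 * (z1^-1 * A) = z2^-1 * A by rewrite -mulgA mulVKg.
  have h := wle_trans z21 b1; move: h z21 b1 => /eqP h1 /eqP h2 /eqP h3.
  by clear -h1 h2 h3; glia.
by rewrite invgM -!mulgA mulKg mulVKg.
Qed.

Lemma act1 L : act 1 L = L.
Proof.
elim: L => [|A L IH] /=; first by rewrite eqxx.
have -> : wmeet A (1^-1 * w0) = A.
  have [h1 h2 h3] := wmeetP A (1^-1 * w0).
  apply: wle_eq h1 _; apply/wle_len/h3; first exact: wle_refl.
  by rewrite invg1 mul1g; apply: wle_w0.
by rewrite mul1g mulVg IH.
Qed.

Definition actw (w : seq S) (L : seq W) : seq W := foldr (fun s => act (gen s)) L w.

Lemma actw_cat u v L : actw (u ++ v) L = actw u (actw v L).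
Proof. exact: foldr_cat. Qed.

Lemma actw_reduced w L : reduced m w -> actw w L = act (wc w) L.
Proof.
elim: w => [|s w IH] h; first by rewrite wc0 act1.
have [h1 h2] := reduced_cons h.
by rewrite /= IH // -act_mul -?wcS // wcS len_gen ndesc.
Qed.

(** The two sides of a braid relation are reduced words of one group element, and a reduced word
    acts through that element. *)
Lemma actw_congr u v : congr braid_pres u v -> actw u = actw v.
Proof.
elim=> [{}u {}v h|//|? ? _ -> //|? ? ? _ -> _ -> //].
apply: functional_extensionality => L.
case: h => x y s t st; rewrite !actw_cat; congr (actw x _).
have ts : t != s by rewrite eq_sym.
have h := reduced_alt ts; rewrite (hm_sym t s) in h.
by rewrite actw_reduced ?reduced_alt // braidW // (actw_reduced _ h).
Qed.

Definition NF (x : M) : seq W := actw (repr x) [::].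

Lemma NF_mc w : NF (mc w) = actw w [::].
Proof. by rewrite /NF (actw_congr (repr_cls braid_pres w)). Qed.

Lemma NF_lift u y : NF (lift u * y) = act u (NF y).
Proof.
rewrite -{1}(mc_repr y) -mcM NF_mc actw_cat actw_reduced ?rwK //.
exact: rw_reduced.
Qed.

Definition ev (L : seq W) : M := foldr (fun A x => lift A * x) 1 L.

Lemma ev_act u L : ev (act u L) = lift u * ev L.
Proof.
elim: L u => [|A L IH] u /=.
  by case: eqP => [->|_] /=; rewrite ?lift1 mulg1.
have [h1 h2 h3] := wmeetP A (u^-1 * w0).
rewrite liftM; last exact/additive_le.
by rewrite IH -mulgA; congr mul; rewrite mulgA -lift_le.
Qed.

Lemma ev_NF x : ev (NF x) = x.
Proof.
rewrite -{2}(mc_repr x) /NF; elim: (repr x) => [|s w IH] //=.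
by rewrite ev_act IH lift_gen -mcM.
Qed.

Definition alpha (x : M) : W := head 1 (NF x).
Definition omega (x : M) : M := ev (behead (NF x)).

Lemma alpha_omega x : x = lift (alpha x) * omega x.
Proof.
rewrite -{1}(ev_NF x) /alpha /omega; case: (NF x) => [|A L] //=.
by rewrite lift1 mulg1.
Qed.

Lemma alpha_lift u y : wle u (alpha (lift u * y)).
Proof.
rewrite /alpha NF_lift; case: (NF y) => [|A L] /=.
  by case: eqP => [->|_]; apply: wle_refl.
rewrite wle_cat; apply/eqP/additive_le.
by have [] := wmeetP A (u^-1 * w0).
Qed.

(** The right side depends on [u] and [act u L] only, whence left cancellation. For nonempty [L] the
    head of [act u L] is [u * z], so removing [u] gives back the prefix [z] taken from [L]. *)
Lemma ev_recover u L :
  ev L = lift (u^-1 * head 1 (act u L)) * ev (behead (act u L)).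
Proof.
case: L => [|A L] /=.
  by case: eqP => [->|_] /=; rewrite ?invg1 ?mulVg !mulg1 lift1.
rewrite mulKg ev_act mulgA; congr mul; apply: lift_le.
by have [] := wmeetP A (u^-1 * w0).
Qed.

Lemma lift_cancel u x y : lift u * x = lift u * y -> x = y.
Proof.
move=> /(congr1 NF); rewrite !NF_lift => E.
by rewrite -(ev_NF x) -(ev_NF y) (ev_recover u) E -ev_recover.
Qed.

Lemma M_cancel (a x y : M) : a * x = a * y -> x = y.
Proof.
elim/cls_ind: a x y => [|s a IH] x y; first by rewrite !mul1g.
rewrite -!mulgA -[cls [:: s]]/(mc [:: s]) -lift_gen => /lift_cancel.
exact: IH.
Qed.

(** * Length and divisibility in the positive monoid *)

Definition mlen (x : M) := size (repr x).

Lemma size_braid u v : congr braid_pres u v -> size u = size v.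
Proof.
elim=> [{}u {}v h|//|? ? _ -> //|? ? ? _ -> _ -> //].
by case: h => x y s t st; rewrite !size_cat !size_alt.
Qed.

Lemma mlen_mc w : mlen (mc w) = size w.
Proof. exact/size_braid/repr_cls. Qed.

Lemma mlenM x y : mlen (x * y) = mlen x + mlen y.
Proof. by rewrite -{1}(mc_repr x) -{1}(mc_repr y) -mcM mlen_mc size_cat. Qed.

Lemma mlen_lift x : mlen (lift x) = len x. Proof. exact: mlen_mc. Qed.

Lemma mlen_eq0 x : mlen x = 0 -> x = 1.
Proof. by move=> /size0nil h; rewrite -(mc_repr x) h. Qed.

Definition mdvd (x y : M) := exists z, y = x * z.

Lemma mdvd_lift u x : mdvd (lift u) x <-> wle u (alpha x).
Proof.
split=> [[y ->]|h]; first exact: alpha_lift.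
exists (lift (u^-1 * alpha x) * omega x).
by rewrite mulgA -lift_le // -alpha_omega.
Qed.

Lemma mstarts s x :
  starts (fun s (x : M) => mc [:: s] * x) (fun _ _ => True) s x <->
  desc s (alpha x).
Proof.
rewrite wle_gen; split=> [[y [_ ->]]|/mdvd_lift[y ->]].
  by rewrite -lift_gen; apply: alpha_lift.
by exists y; rewrite lift_gen.
Qed.

Lemma mgcd (x y : M) :
  exists g, [/\ mdvd g x, mdvd g y & forall h, mdvd h x -> mdvd h y -> mdvd h g].
Proof.
apply: (@meets M S 1 (fun s x => mc [:: s] * x) (fun _ _ => True) mlen mdvd).
- by move=> a; exists 1; rewrite mulg1.
- by move=> b a c [u ->] [v ->]; exists (u * v); rewrite mulgA.
- by move=> a; exists a; rewrite mul1g.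
- by move=> a b [u ->]; rewrite mlenM leq_addr.
- move=> a b [u ->]; rewrite mlenM => h.
  by rewrite [u]mlen_eq0 ?mulg1 //; lia.
- by move=> s a _; rewrite mlenM mlen_mc.
- move=> a; rewrite -(mc_repr a); case: (repr a) => [|s w]; [by left|right].
  by exists s, (mc w); rewrite -mcS.
- by move=> s a b _ _; apply: M_cancel.
- move=> s a b _ _; split=> [[u]|[u ->]]; last by exists u; rewrite mulgA.
  by rewrite -mulgA => /M_cancel ->; exists u.
- by [].
- by move=> s a b _ [u ->]; exists (a * u); rewrite mulgA.
move=> s t; case: (eqVneq s t) => [->|st]; [by left|right].
have := hm2 st; case Em : (m s t) => [|k] // _.
exists (mc (alt t s k)), (mc (alt s t k)); rewrite -!mcS -!altS -Em.
split=> //; first by rewrite braidM.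
(* If [z] begins with [s] and with [t], both are descents of [alpha z], so their alternating word of
   length [m] divides [z]. *)
move=> z /mstarts h1 /mstarts h2.
rewrite -lift_reduced; last exact: reduced_alt.
by apply/mdvd_lift/wle_alt.
Qed.

(** * The Garside element and conjugation by it *)

Definition D : M := lift w0.

Lemma w0sq : w0 * w0 = 1.
Proof.
apply: len_eq0; have := len_w0 w0^-1; rewrite lenV invgK; glia.
Qed.

(** [gen s * w0] is the complement of [gen s], and the conjugate is the complement of [gen s * w0];
    so it has length one. *)
Lemma w0_conj s : exists t, gen t = w0^-1 * (gen s * w0).
Proof.
have h1 := len_w0 (gen s * w0); have h2 := len_w0 (gen s).
rewrite genV len_gen in h2; rewrite invgM genV -mulgA in h1.
have : len (w0^-1 * (gen s * w0)) = 1%N by glia.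
rewrite /len; set x := w0^-1 * _; case E : (rw x) => [|t [|]] //= _.
by exists t; rewrite -(rwK x) E.
Qed.

Definition bar s := sval (constructive_indefinite_description _ (w0_conj s)).
Lemma gen_bar s : gen (bar s) = w0^-1 * (gen s * w0).
Proof. by rewrite /bar; case: constructive_indefinite_description. Qed.

Lemma barK : involutive bar.
Proof.
move=> s; apply: gen_inj; rewrite !gen_bar.
have -> : w0^-1 = w0 by apply: mulg1_eq; apply: w0sq.
by rewrite -!mulgA w0sq mulg1 mulgA w0sq mul1g.
Qed.

Lemma gen_D s : mc [:: s] * D = D * mc [:: bar s].
Proof.
have E : gen s * w0 * gen (bar s) = w0.
  by rewrite gen_bar -mulgA mulVKg genK.
have h2 := len_w0 (gen s); rewrite genV len_gen in h2.
have -> : mc [:: s] * D = mc [:: s] * (lift (gen s * w0) * mc [:: bar s]).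
  by congr mul; rewrite -lift_gen -liftM E // len_gen; glia.
rewrite mulgA -!lift_gen -liftM genK //.
by rewrite len_gen; glia.
Qed.

(** * The positive monoid in the Artin group *)

Lemma bar_conj x : exists2 y, x * D = D * y & mlen y = mlen x.
Proof.
elim/cls_ind: x => [|s x [y E l]]; first by exists 1; rewrite ?mul1g ?mulg1.
rewrite -[cls [:: s]]/(mc [:: s]).
exists (mc [:: bar s] * y); last by rewrite !mlenM !mlen_mc l.
by rewrite -mulgA E mulgA gen_D mulgA.
Qed.

Lemma D_left x : exists y, D * x = y * D.
Proof.
elim/cls_ind: x => [|s x [y E]]; first by exists 1; rewrite mul1g mulg1.
rewrite -[cls [:: s]]/(mc [:: s]); exists (mc [:: bar s] * y).
by rewrite -mulgA -E !mulgA gen_D barK.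
Qed.

Definition D2 : M := D * D.

Lemma D2_central x : x * D2 = D2 * x.
Proof.
elim/cls_ind: x => [|s x E]; first by rewrite mul1g mulg1.
rewrite -[cls [:: s]]/(mc [:: s]) -mulgA E /D2.
by rewrite !mulgA gen_D -(mulgA D) gen_D barK mulgA.
Qed.

Lemma D2X_central x k : x * D2 ^+ k = D2 ^+ k * x.
Proof. exact/commuteX/D2_central. Qed.

Lemma D2X_cancel k x y : x * D2 ^+ k = y * D2 ^+ k -> x = y.
Proof. by rewrite !D2X_central => /M_cancel. Qed.

(** The element [s^-1 D2] written positively, so that an inverse letter costs one factor [D2]. *)
Definition comp s : M := lift (gen s * w0) * D.

Lemma comp_r s : mc [:: s] * comp s = D2.
Proof.
have h2 := len_w0 (gen s); rewrite genV len_gen in h2.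
by rewrite mulgA -lift_gen -liftM genK // len_gen; glia.
Qed.

Lemma comp_l s : comp s * mc [:: s] = D2.
Proof.
by apply: (M_cancel (a := mc [:: s])); rewrite mulgA comp_r -D2_central.
Qed.

(* The word [w] equals [phi w * D2 ^- neg w] in the Artin group. *)
Definition phi (w : seq (letter S)) : M :=
  foldr (fun l x => (if l.2 then mc [:: l.1] else comp l.1) * x) 1 w.
Definition neg (w : seq (letter S)) := count (fun l => ~~ l.2) w.

Lemma phi_cat u v : phi (u ++ v) = phi u * phi v.
Proof. by elim: u => [|l u IH] /=; rewrite ?mul1g // IH mulgA. Qed.

Lemma phi_pos w : phi (pos w) = mc w.
Proof. by elim: w => [|s w IH] //=; rewrite IH -mcS. Qed.

Lemma neg_pos w : neg (pos w) = 0.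
Proof. by elim: w. Qed.

(** Equality of the fractions [phi w / D2 ^+ neg w] with denominators cleared; transitivity rests on
    cancelling central powers of [D2]. *)
Lemma phi_congr u v : aeq m u v -> phi u * D2 ^+ neg v = phi v * D2 ^+ neg u.
Proof.
elim=> [{}u {}v h|//|? ? _ -> //|x y z _ h1 _ h2].
  case: h => [x y s b|x y s t st].
    rewrite !phi_cat /neg !count_cat -/(neg x) -/(neg y).
    have -> : phi [:: (s, b); (s, ~~ b)] = D2.
      by case: b => /=; rewrite mulg1 ?comp_r ?comp_l.
    have -> : count (fun l : letter S => ~~ l.2) [:: (s, b); (s, ~~ b)] = 1%N.
      by case: b.
    by rewrite addnCA add1n expgS -(D2_central (phi y)) !mulgA.
  rewrite !phi_cat !phi_pos braidM // /neg !count_cat.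
  by rewrite -!/(neg _) !neg_pos.
apply: (D2X_cancel (k := neg y)).
rewrite -!mulgA -!expgnDr (addnC (neg z)) expgnDr mulgA h1 -mulgA -expgnDr.
by rewrite addnC expgnDr mulgA h2 -mulgA -expgnDr addnC.
Qed.

Notation A := (A m).
Notation ac := (@ac S m).

Definition iM (x : M) : A := ac (pos (repr x)).

Lemma pos_cat (u v : seq S) : pos (u ++ v) = pos u ++ pos v.
Proof. exact: map_cat. Qed.

Lemma pos_congr u v : congr braid_pres u v -> ac (pos u) = ac (pos v).
Proof.
elim=> [{}u {}v h|//|? ? _ -> //|? ? ? _ -> _ -> //].
case: h => x y s t st; apply/acP/rst_step.
by rewrite !pos_cat; apply: art_braid.
Qed.

Lemma iM_mc w : iM (mc w) = ac (pos w).
Proof. exact/pos_congr/repr_cls. Qed.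

Lemma iMM x y : iM (x * y) = iM x * iM y.
Proof. by rewrite -(mc_repr x) -(mc_repr y) -mcM !iM_mc pos_cat acM. Qed.

Lemma iM1 : iM 1 = 1. Proof. exact: (iM_mc [::]). Qed.

Lemma iMX x n : iM (x ^+ n) = iM x ^+ n.
Proof. by elim: n => [|n IH]; rewrite ?expg0 ?iM1 // !expgS iMM IH. Qed.

(** Garside's embedding theorem: positive words have trivial denominators, so equal fractions have
    equal numerators. *)
Lemma iM_inj : injective iM.
Proof.
move=> x y /acP/phi_congr; rewrite !neg_pos !phi_pos !mc_repr.
by rewrite !expg0 !mulg1.
Qed.

Lemma exps_iM x : exps (iM x) = Z.of_nat (mlen x).
Proof. by rewrite exps_ac weight_pos. Qed.

(** * Bounds by powers of Delta *)

Definition DA : A := iM D.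

Lemma D2A_central (a : A) : a * iM D2 = iM D2 * a.
Proof.
elim/cls_ind: a => [|[s b] a IH]; first by rewrite mul1g mulg1.
change (ac [:: (s, b)] * a * iM D2 = iM D2 * (ac [:: (s, b)] * a)).
rewrite -mulgA IH !mulgA; congr mul.
have h : ac [:: (s, true)] * iM D2 = iM D2 * ac [:: (s, true)].
  by rewrite -[ac _](iM_mc [:: s]) -!iMM D2_central.
case: b => //; rewrite acN.
by apply/esym/commuteV.
Qed.

Lemma DA2_central (a : A) k : a * DA ^+ (2 * k) = DA ^+ (2 * k) * a.
Proof. by rewrite expgnA expg2 -iMM; apply/commuteX/D2A_central. Qed.

(* [posn a k] : [- k <= inf a] *)
Definition posn (a : A) k := exists x, DA ^+ k * a = iM x.

Lemma iM_DA x k : exists2 y, iM x * DA ^+ k = DA ^+ k * iM y & mlen y = mlen x.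
Proof.
elim: k => [|k [y E l]]; first by exists x; rewrite ?expg0 ?mulg1 ?mul1g.
have [z E' l'] := bar_conj y; exists z; last by rewrite l'.
by rewrite expgSr mulgA E -mulgA -iMM E' iMM mulgA.
Qed.

Lemma DA_iM x k : exists y, DA ^+ k * iM x = iM y * DA ^+ k.
Proof.
elim: k => [|k [y E]]; first by exists x; rewrite ?expg0 ?mulg1 ?mul1g.
have [z E'] := D_left y; exists z.
by rewrite expgS -mulgA E mulgA -iMM E' iMM mulgA.
Qed.

Lemma posn_mul a b j k : posn a j -> posn b k -> posn (a * b) (j + k).
Proof.
move=> [x Ea] [y Eb]; have [z Ez] := DA_iM x k; exists (z * y).
by rewrite addnC expgnDr -mulgA (mulgA _ a) Ea mulgA Ez -mulgA Eb -iMM.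
Qed.

Lemma posn1 k : posn 1 k.
Proof. by exists (D ^+ k); rewrite mulg1 iMX. Qed.

Lemma posn_add a j k : posn a j -> posn a (j + k).
Proof. by move=> h; rewrite -[a]mulg1; apply: posn_mul => //; apply: posn1. Qed.

Lemma posn_leq a j k : j <= k -> posn a j -> posn a k.
Proof. by move=> /subnKC <-; apply: posn_add. Qed.

Lemma posn_exp a k n : posn a k -> posn (a ^+ n) (k * n).
Proof.
move=> h; elim: n => [|n IH]; first by rewrite expg0; apply: posn1.
by rewrite expgS mulnS; apply: posn_mul.
Qed.

(** Two factors Delta suffice for a letter of either sign, [comp s] serving for [s^-1], and bounds
    add up in products. *)
Lemma ex_posn a : exists k, posn a k.
Proof.
elim/cls_ind: a => [|[s b] a [k h]]; first by exists 0; apply: posn1.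
have : posn (ac [:: (s, b)]) 2; last by exists (2 + k); apply: posn_mul.
case: b; first by exists (D2 * mc [:: s]); rewrite expg2 !iMM iM_mc.
exists (comp s); rewrite acN expg2 -iMM -/D2 -(comp_l s) iMM.
by rewrite iM_mc mulgK.
Qed.

Lemma posn_bound a n : exists C, forall i, i <= n -> posn (a ^+ i) C.
Proof.
elim: n => [|n [C h]].
  by exists 0; case=> // _; rewrite expg0; apply: posn1.
have [k hk] := ex_posn (a ^+ n.+1); exists (C + k) => i.
rewrite leq_eqVlt => /orP[/eqP ->|lt]; first by rewrite addnC; apply: posn_add.
exact/posn_add/h.
Qed.

(** * The lattice order on the Artin group *)

Definition ale (a b : A) := exists x, b = a * iM x.

Lemma ale_trans b a c : ale a b -> ale b c -> ale a c.
Proof. by move=> [x ->] [y ->]; exists (x * y); rewrite iMM mulgA. Qed.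

Lemma ale_mul c a b : ale (c * a) (c * b) <-> ale a b.
Proof.
split=> [[x]|[x ->]]; last by exists x; rewrite mulgA.
by rewrite -mulgA => /mulgI ->; exists x.
Qed.

Lemma ale_exps a b : ale a b -> (exps a <= exps b)%Z.
Proof. by move=> [x ->]; rewrite expsM exps_iM; lia. Qed.

Lemma ale_eq a b : ale a b -> exps a = exps b -> a = b.
Proof.
move=> [x ->]; rewrite expsM exps_iM => h.
by rewrite [x]mlen_eq0 ?iM1 ?mulg1 //; lia.
Qed.

Lemma ale_iM x y : ale (iM x) (iM y) <-> mdvd x y.
Proof.
split=> [[z]|[z ->]]; last by exists z; rewrite iMM.
by rewrite -iMM => /iM_inj ->; exists z.
Qed.

Lemma mdvd_mul c x y : mdvd (c * x) (c * y) <-> mdvd x y.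
Proof.
split=> [[u]|[u ->]]; last by exists u; rewrite mulgA.
by rewrite -mulgA => /M_cancel ->; exists u.
Qed.

Lemma posn_ale a k : posn a k <-> ale (DA ^- k) a.
Proof.
split=> [[x E]|[x ->]]; last by exists x; rewrite mulVKg.
by exists x; rewrite -E mulKg.
Qed.

(** A common power of Delta moves [a] and [b] into the positive monoid, where greatest common
    divisors exist. *)
Lemma ameet (a b : A) :
  exists g, [/\ ale g a, ale g b & forall h, ale h a -> ale h b -> ale h g].
Proof.
have [j hj] := ex_posn a; have [k hk] := ex_posn b.
have [x Ex] := posn_add k hj.
have [y Ey] : posn b (j + k) by rewrite addnC; apply: posn_add.
have [g [gx gy gm]] := mgcd x y; set n := (j + k)%N in Ex Ey.
exists (DA ^- n * iM g); split.
- by apply/(ale_mul (DA ^+ n)); rewrite mulVKg Ex; apply/ale_iM.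
- by apply/(ale_mul (DA ^+ n)); rewrite mulVKg Ey; apply/ale_iM.
move=> h ha hb; have [l [z Ez]] := ex_posn h.
have lift_le c w : DA ^+ n * c = iM w -> ale h c -> mdvd (D ^+ n * z) (D ^+ l * w).
  move=> Ec hc; have [w' Ew'] : posn c n by exists w.
  apply/ale_iM; rewrite !iMM !iMX -/DA -Ez -Ec !mulgA -!expgnDr addnC.
  exact/ale_mul.
have hx := lift_le _ _ Ex ha; have hy := lift_le _ _ Ey hb.
(* [h] need not become positive under the same shift, so a further [D ^+ l] is put in front; the new
   greatest common divisor [g'] still divides [D ^+ l * g]. *)
have [g' [g1 g2 g3]] := mgcd (D ^+ l * x) (D ^+ l * y).
have [u Eu] : mdvd (D ^+ l) g' by apply: g3; [exists x|exists y].
have ug : mdvd u g.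
  by apply: gm; apply/(mdvd_mul (D ^+ l)); rewrite -Eu.
have : mdvd (D ^+ n * z) (D ^+ l * g).
  have [v ->] := ug; have [v' E'] := g3 _ hx hy.
  by exists (v' * v); rewrite mulgA -Eu E' mulgA.
move/ale_iM; rewrite !iMM !iMX -/DA -Ez mulgA -expgnDr addnC expgnDr -mulgA.
move/ale_mul => h'; apply/(ale_mul (DA ^+ n)).
by rewrite mulVKg.
Qed.

Definition meetA a b := sval (constructive_indefinite_description _ (ameet a b)).

Lemma meetAP a b : [/\ ale (meetA a b) a, ale (meetA a b) b &
  forall h, ale h a -> ale h b -> ale h (meetA a b)].
Proof. by rewrite /meetA; case: constructive_indefinite_description. Qed.

(** * Growth of orbits *)

Section Orbit.
Variable y : A.
Hypothesis y0 : exps y = 0%Z.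

(* [zmeet j] is the meet of [1, y, ..., y ^+ j] *)
Fixpoint zmeet j := if j is i.+1 then meetA 1 (y * zmeet i) else 1.

Lemma zmeet_greatest b j : (forall i, i <= j -> ale b (y ^+ i)) -> ale b (zmeet j).
Proof.
elim: j b => [|j IH] b h /=; first by have := h 0; rewrite expg0; apply.
have [_ _ hm] := meetAP 1 (y * zmeet j); apply: hm.
  by have := h 0; rewrite expg0; apply.
rewrite -[b](mulVKg y); apply/ale_mul/IH => i ij.
apply/(ale_mul y); rewrite mulVKg -expgS.
exact: h.
Qed.

Lemma zmeet_decr j : ale (zmeet j.+1) (zmeet j).
Proof.
elim: j => [|j IH]; first by have [] := meetAP 1 (y * 1).
have [h1 h2 _] := meetAP 1 (y * zmeet j.+1).
have [_ _ hm] := meetAP 1 (y * zmeet j).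
apply: hm => //; apply: ale_trans h2 _.
exact/ale_mul.
Qed.

Lemma zmeet_exps j : y <> 1 -> (exps (zmeet j) <= - Z.of_nat j)%Z.
Proof.
move=> y1; elim: j => [|j IH]; first by rewrite /= exps1.
have le := ale_exps (zmeet_decr j).
suff : exps (zmeet j.+1) <> exps (zmeet j) by lia.
move=> E; apply: y1; have Ez := ale_eq (zmeet_decr j) E.
have [_ h2 _] := meetAP 1 (y * zmeet j).
have := ale_eq h2; rewrite -/(zmeet j.+1) Ez => h.
apply: (mulIg (zmeet j)); rewrite mul1g -h //.
by rewrite expsM y0.
Qed.

(* Otherwise the meets [zmeet j], whose exponent sum decreases strictly, would
   be bounded below by a power of [Delta] of too small a slope. *)
Lemma orbit_growth n k x : y <> 1 -> DA ^+ k * y ^+ n = iM x -> n <= mlen x.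
Proof.
move=> y1 E; rewrite leqNgt; apply/negP => lt.
have Ek : mlen x = (len w0 * k)%N.
  have : exps (DA ^+ k * y ^+ n) = exps (iM x) by rewrite E.
  rewrite expsM !expsX y0 !exps_iM mlen_lift; lia.
have hn : posn (y ^+ n) k by exists x.
have [C hC] := posn_bound y n.
(* As [n] exceeds [mlen x], running to [n * q] gains at least [q], which is more than the error
   [len w0 * C]. *)
pose q := (len w0 * C).+1.
have : ale (DA ^- (k * q + C)) (zmeet (n * q)).
  apply: zmeet_greatest => i iq; apply/posn_ale.
  have n0 : 0 < n by case: (n) lt.
  rewrite (divn_eq i n) expgnDr mulnC expgnA; apply: posn_mul.
    apply: (posn_leq (j := k * (i %/ n))); last exact: posn_exp.
    rewrite leq_mul2l; apply/orP; right; rewrite -(mulKn q n0).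
    exact: leq_div2r.
  by apply: hC; apply/ltnW/ltn_pmod.
move/ale_exps; have := zmeet_exps (j := (n * q)%N) y1.
rewrite expsV expsX exps_iM mlen_lift => h1 h2.
have : (n * q <= len w0 * (k * q + C))%N by lia.
rewrite mulnDr mulnA -Ek => h3.
have : ((mlen x).+1 * q <= n * q)%N by rewrite leq_mul2r lt orbT.
by rewrite mulSn /q; lia.
Qed.

End Orbit.

(** * Special representatives *)

Section Words.
Variable d : seq S.
Hypothesis wc_d : wc d = w0.
Hypothesis d_red : reduced m d.
Hypothesis d_gt0 : 0 < size d.

Lemma D_mc : D = mc d.
Proof. by rewrite /D -wc_d lift_reduced. Qed.

Lemma DA_ac : DA = ac (pos d).
Proof. by rewrite /DA D_mc iM_mc. Qed.

Lemma size_d : size d = len w0.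
Proof. by rewrite -wc_d (eqP d_red). Qed.

Definition Dz (k : Z) : A := ac (dpowZ d k).

Lemma DzE (k : Z) a b : (k = Z.of_nat a - Z.of_nat b)%Z -> Dz k = DA ^+ a * DA ^- b.
Proof.
rewrite /Dz; case: k => [|q|q] /= E.
- have -> : a = b by lia.
  by rewrite mulgV.
- have -> : a = (Pos.to_nat q + b)%N by lia.
  by rewrite acX -DA_ac expgnDr mulgK.
have -> : b = (Pos.to_nat q + a)%N by lia.
by rewrite acX acV -DA_ac expVgn expgnDr invgM mulVKg.
Qed.

Lemma Dz_nat n : Dz (Z.of_nat n) = DA ^+ n.
Proof. by rewrite (DzE (a := n) (b := 0)) ?expg0 ?invg1 ?mulg1 //; lia. Qed.

Lemma DzD j k : Dz (j + k) = Dz j * Dz k.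
Proof.
pose a := Z.to_nat j; pose b := Z.to_nat (- j).
pose a' := Z.to_nat k; pose b' := Z.to_nat (- k).
rewrite (DzE (k := j) (a := a) (b := b)) /a /b; last lia.
rewrite (DzE (k := k) (a := a') (b := b')) /a' /b'; last lia.
rewrite -/a -/b -/a' -/b' (DzE (a := a + a') (b := b' + b)) /a /a' /b /b'; last lia.
rewrite -/a -/b -/a' -/b' !expgnDr invgM -!mulgA; congr mul.
rewrite !mulgA; congr mul.
exact/commuteV/commuteX2.
Qed.

Lemma DzX k n : Dz (Z.of_nat n * k) = Dz k ^+ n.
Proof.
elim: n => [|n IH]; first by rewrite expg0.
by rewrite expgS -IH -DzD; congr Dz; lia.
Qed.

Lemma exps_Dz k : exps (Dz k) = (k * Z.of_nat (size d))%Z.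
Proof.
pose a := Z.to_nat k; pose b := Z.to_nat (- k).
rewrite (DzE (a := a) (b := b)) /a /b; last lia.
by rewrite expsM expsV !expsX DA_ac exps_ac weight_pos; lia.
Qed.

Lemma Dz_even k (a : A) : a * Dz (2 * k) = Dz (2 * k) * a.
Proof.
pose i := Z.to_nat k; pose j := Z.to_nat (- k).
rewrite (DzE (a := 2 * i) (b := 2 * j)) /i /j; last lia.
by apply: commuteM; [|apply: commuteV]; apply: DA2_central.
Qed.

Lemma Dz_iM k x : exists2 y, iM x * Dz k = Dz k * iM y & mlen y = mlen x.
Proof.
(* Adding [2 * Z.abs k] makes the exponent natural, and the even power taken back is central. *)
pose i := Z.to_nat (k + 2 * Z.abs k).
have -> : k = (Z.of_nat i + 2 * - Z.abs k)%Z by rewrite /i; lia.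
have [y E l] := iM_DA x i; exists y => //.
by rewrite DzD Dz_nat mulgA E -!mulgA Dz_even.
Qed.

Lemma atomP a : atom m a <-> reduced m a.
Proof.
by split=> [h|/reducedP h]; [apply/reducedP|] => v /wcP; apply: h.
Qed.

Lemma aeq_pos u v : aeq m (pos u) (pos v) <-> mc u = mc v.
Proof.
rewrite -acP -!iM_mc; split=> [/iM_inj //|-> //].
Qed.

Lemma pdivP x y : pdiv m x y <-> mdvd (mc x) (mc y).
Proof.
split=> [[z /aeq_pos <-]|[z E]]; first by exists (mc z); rewrite mcM.
by exists (repr z); apply/aeq_pos; rewrite mcM mc_repr.
Qed.

Lemma is_alpha_congr a p q : mc p = mc q -> is_alpha m a p -> is_alpha m a q.
Proof.
move=> E [h1 [h2 h3]]; split=> //; split; first by apply/pdivP; rewrite -E; apply/pdivP.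
by move=> b hb /pdivP; rewrite -E => /pdivP; apply: h3.
Qed.

Lemma is_alpha_rw p : is_alpha m (rw (alpha (mc p))) p.
Proof.
split; first exact/atomP/rw_reduced.
split; first by apply/pdivP/(mdvd_lift (alpha _)); apply: wle_refl.
move=> b /atomP hb /pdivP; rewrite -lift_reduced // => /mdvd_lift h.
apply/pdivP; rewrite -lift_reduced //.
by exists (lift ((wc b)^-1 * alpha (mc p))); apply: lift_le.
Qed.

(** The greatest atom is split off; the first letter divides it, so the remainder is shorter. *)
Lemma ex_normal_form p : exists L, normal_form m L p.
Proof.
have [n] := ubnP (size p); elim: n p => // n IH p /ltnSE pn.
case: p pn => [|s p] pn.
  by exists [::]; split; [apply: rst_refl|split].
set q := s :: p in pn *; set a := rw (alpha (mc q)).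
pose r := repr (omega (mc q)).
have Eq : mc q = mc a * mc r by rewrite mc_repr -alpha_omega.
have a0 : 0 < size a.
  have : mdvd (lift (gen s)) (mc q) by exists (mc p); rewrite lift_gen -mcS.
  by move/mdvd_lift/wle_len; rewrite len_gen.
have [|L [h1 [h2 h3]]] := IH r.
  have := mlen_mc q; rewrite Eq mlenM !mlen_mc; lia.
have E : mc (flatten (a :: L)) = mc q.
  by rewrite Eq /= mcM; congr mul; apply/aeq_pos.
exists (a :: L); split; first exact/aeq_pos.
split=> [b|[|i] iL]; last exact: h3.
  rewrite inE => /orP[/eqP ->|/h2 //]; split; first exact/atomP/rw_reduced.
  by move/(aeq_pos a [::])/(congr1 mlen); rewrite !mlen_mc => a_nil; rewrite a_nil in a0.
by apply: is_alpha_congr (is_alpha_rw q); rewrite drop0.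
Qed.

(** If [D] divided [p], it would divide the first factor, the greatest atom below [p]; that atom is
    no longer than [d], hence equal to Delta. *)
Lemma special_ndvd L p : normal_form m L p ->
  (forall a, a \in L -> ~ aeq m (pos a) (pos d)) -> ~ mdvd D (mc p).
Proof.
move=> [h1 [h2 h3]] h; move/aeq_pos: h1 => <-; rewrite D_mc => hD.
case: L h2 h3 h hD => [|a L] h2 h3 h hD.
  by have [z /(congr1 mlen)] := hD; rewrite mlenM !mlen_mc /=; lia.
have [ha [_ hmax]] : is_alpha m a (flatten (a :: L)) by have := h3 0 isT.
have /pdivP[z E] : pdiv m d a.
  by apply: hmax; [apply/atomP|apply/pdivP].
apply: (h a); first exact: mem_head.
move/atomP: ha => /eqP ha; have := w0_max (wc a); rewrite ha -size_d => h4.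
apply/aeq_pos; rewrite E [z]mlen_eq0 ?mulg1 //.
by move/(congr1 mlen): E; rewrite mlenM !mlen_mc; lia.
Qed.

(** A factor Delta in any position can be moved to the front, conjugating the factors before it. *)
Lemma ndvd_special p : ~ mdvd D (mc p) -> exists2 L, normal_form m L p &
  forall a, a \in L -> ~ aeq m (pos a) (pos d).
Proof.
move=> h; have [L hL] := ex_normal_form p; exists L => // a aL /aeq_pos E.
apply: h; have [/aeq_pos <- _] := hL.
case/splitPr: aL {hL} => L1 L2; rewrite flatten_cat /= !mcM E -D_mc mulgA.
have [y -> _] := bar_conj (mc (flatten L1)).
by exists (y * mc (flatten L2)); rewrite mulgA.
Qed.

Lemma split_D x : exists j q, x = q * D ^+ j /\ ~ mdvd D q.
Proof.
have [n] := ubnP (mlen x); elim: n x => // n IH x /ltnSE xn.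
case: (excluded_middle_informative (mdvd D x)) => [[y E]|N]; last first.
  by exists 0, x; rewrite expg0 mulg1.
have [z Ez] := D_left y; rewrite Ez in E.
have [|j [q [Eq h]]] := IH z.
  by move: xn; rewrite E mlenM D_mc mlen_mc; lia.
by exists j.+1, q; rewrite expgSr mulgA -Eq.
Qed.

Lemma special_repP x p : special_rep m d x p <->
  (exists k, iM (mc p) = ac x * Dz k) /\ ~ mdvd D (mc p).
Proof.
split=> [[[k /acP E] [L h1 h2]]|[[k E] h]]; split.
- by exists k; rewrite iM_mc E acM.
- exact: special_ndvd h1 h2.
- by exists k; apply/acP; rewrite -iM_mc E acM.
- exact: ndvd_special.
Qed.

Lemma ex_special x : exists p, special_rep m d x p.
Proof.
have [k [y E]] := ex_posn (ac x); have [z Ez _] := iM_DA y k.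
have Ex : ac x * DA ^+ k = iM z.
  by apply: (mulgI (DA ^+ k)); rewrite mulgA E.
have [j [q [Eq h]]] := split_D z.
exists (repr q); apply/special_repP; rewrite mc_repr; split=> //.
exists (Z.of_nat k - Z.of_nat j)%Z; rewrite (DzE erefl) mulgA Ex Eq.
by rewrite iMM iMX mulgK.
Qed.

(** The special representative is shortest among the positive elements of its coset: with [k > l] it
    would be [r] times a positive power of Delta, which [D] divides. *)
Lemma special_min x p r l : special_rep m d x p -> iM r = ac x * Dz l ->
  size p <= mlen r.
Proof.
move=> /special_repP[[k E] N] Er.
have le : (k <= l)%Z.
  case: (Z_le_gt_dec k l) => // gt; case: N.
  pose n := Z.to_nat (k - l - 1); have En : k = (l + Z.of_nat n.+1)%Z by lia.
  have [y Ey _] := bar_conj (r * D ^+ n); exists y; rewrite -Ey.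
  apply: iM_inj; rewrite E En DzD Dz_nat mulgA -Er expgSr mulgA.
  by rewrite !iMM iMX.
have e1 : exps (iM (mc p)) = exps (ac x * Dz k) by rewrite E.
have e2 : exps (iM r) = exps (ac x * Dz l) by rewrite Er.
move: e1 e2; rewrite !expsM !exps_iM !exps_Dz mlen_mc.
have : (k * Z.of_nat (size d) <= l * Z.of_nat (size d))%Z.
  by apply: Z.mul_le_mono_nonneg_r => //; lia.
lia.
Qed.

Lemma ex_wordnorm x : exists n, wordnorm m d x n.
Proof. by have [p h] := ex_special x; exists (size p), p. Qed.

(** Moving a power of Delta past [q] preserves length, so [p] times the conjugate of [q] is a
    positive element of the coset of [x ++ y]. *)
Lemma wordnorm_mul x y i j k : wordnorm m d x i -> wordnorm m d y j ->
  wordnorm m d (x ++ y) k -> k <= i + j.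
Proof.
move=> [p [/special_repP[[a Ep] _] <-]] [q [/special_repP[[b Eq] _] <-]] [r [hr <-]].
have [z Ez l] := Dz_iM a (mc q).
rewrite -(mlen_mc p) -(mlen_mc q) -l -mlenM; apply: (special_min (l := b + a) hr).
by rewrite iMM Ep -mulgA -Ez Eq acM DzD !mulgA.
Qed.

(** * Growth of the wordnorm along powers *)

Section Translation.
Variable g : seq (letter S).
Hypothesis g_inf : infinite_order_G m d g.
Variable u : nat -> nat.
Hypothesis hu : forall n, wordnorm m d (wpow g n) (u n).

Lemma wpow_cat (w : seq (letter S)) i j : wpow w (i + j) = wpow w i ++ wpow w j.
Proof. by rewrite /wpow nseqD flatten_cat. Qed.

Lemma u_sub i j : u (i + j) <= u i + u j.
Proof. by apply: wordnorm_mul (hu i) (hu j) _; rewrite -wpow_cat. Qed.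

Lemma u0 : u 0 = 0.
Proof.
have [p [hp <-]] := hu 0; apply/eqP; rewrite -leqn0.
have := special_min (r := 1) (l := 0%Z) hp; rewrite (mlen_mc [::]); apply.
by rewrite iM1 /Dz -acM.
Qed.

Lemma u_mul k n : u (k * n) <= k * u n.
Proof.
elim: k => [|k IH]; first by rewrite !mul0n u0.
by rewrite !mulSn (leq_trans (u_sub _ _)) // leq_add2l.
Qed.

Lemma u_growth n : n <= u (2 * size d * n).
Proof.
set N := (2 * size d)%N; pose a := ac g; pose e := exps a.
pose y := a ^+ N * Dz (2 * - e).
have y1 : y <> 1.
  move=> E; apply: (g_inf (n := N) (k := e)); first by rewrite /N; lia.
  apply/acP; rewrite acX -/a -/(Dz _); apply: (mulIg (Dz (2 * - e))).
  by rewrite -/y E -DzD; have -> : (2 * e + 2 * - e = 0)%Z by lia.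
have y0 : exps y = 0%Z.
  by rewrite expsM expsX exps_Dz -/e /N; lia.
have [p [/special_repP[[k E] _] <-]] := hu (N * n).
pose K := (k + Z.of_nat n * (2 * e))%Z.
have Ey : iM (mc p) = y ^+ n * Dz K.
  rewrite E acX -/a expgnA expgMn; last exact: Dz_even.
  rewrite -DzX -mulgA -DzD; congr (_ * Dz _); rewrite /K; lia.
have eK : Z.of_nat (size p) = (K * Z.of_nat (size d))%Z.
  by rewrite -(mlen_mc p) -exps_iM Ey expsM expsX y0 exps_Dz; lia.
(* [K] times the length of Delta is the length of [p], so [Dz K] is a nonnegative power and can be
   moved to the left. *)
have K0 : (0 <= K)%Z by apply/Z.nlt_ge => lt; move: eK; nia.
have EK : K = Z.of_nat (Z.to_nat K) by lia.
rewrite EK Dz_nat in Ey; move: (Z.to_nat K) Ey => i Ey.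
have [z Ez] := DA_iM (mc p) i.
have lz : mlen z = size p.
  have : exps (DA ^+ i * iM (mc p)) = exps (iM z * DA ^+ i) by rewrite Ez.
  by rewrite !expsM !exps_iM mlen_mc; lia.
have Ez' : DA ^+ i * y ^+ n = iM z.
  by apply: (mulIg (DA ^+ i)); rewrite -Ez -mulgA Ey.
by rewrite -lz; apply: orbit_growth Ez'.
Qed.

Lemma u_lower n : n <= 2 * size d * u n.
Proof. exact: leq_trans (u_growth n) (u_mul _ _). Qed.

End Translation.
End Words.

End Longest.
End FiniteType.

(** * Translation length *)

Section Subadditive.
Local Open Scope R_scope.
Variable u : nat -> nat.
Hypothesis u_sub : forall i j, (u (i + j) <= u i + u j)%N.

Lemma subadditive_div q n r : (u (q * n + r) <= q * u n + u r)%N.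
Proof.
elim: q => [|q IH]; first by rewrite !mul0n.
by rewrite !mulSn -!addnA (leq_trans (u_sub _ _)) // leq_add2l.
Qed.

Lemma INR_leq i j : (i <= j)%N -> INR i <= INR j.
Proof. by move=> /leP /le_INR. Qed.

Lemma INR_addn i j : INR (i + j) = INR i + INR j. Proof. exact: plus_INR. Qed.
Lemma INR_muln i j : INR (i * j) = INR i * INR j. Proof. exact: mult_INR. Qed.

(** The limit is the infimum of the ratios, which gives the second clause; completeness provides
    suprema, so the ratios are negated. *)
Lemma fekete : exists l,
  Un_cv (fun n => INR (u n.+1) / INR n.+1) l /\
  forall b, (forall n, b <= INR (u n.+1) / INR n.+1) -> b <= l.
Proof.
pose v n := INR (u n.+1) / INR n.+1.
have pos1 n : 0 < INR n.+1 by apply: lt_0_INR; apply/ltP.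
have v0 n : 0 <= v n.
  by apply: Rmult_le_pos; [apply: pos_INR|apply/Rlt_le/Rinv_0_lt_compat].
pose E x := exists n, x = - v n.
have [l [ub lub]] : {l | is_lub E l}.
  apply: completeness; first by exists 0 => x [n ->]; have := v0 n; lra.
  by exists (- v 0%N), 0%N.
have lv n : - l <= v n by have := ub (- v n) (ex_intro _ n erefl); lra.
exists (- l); split; last first.
  move=> b hb; suff : l <= - b by lra.
  by apply: lub => x [n ->]; have := hb n; rewrite -/(v n); lra.
move=> eps eps0.
have [n hn] : exists n, v n < - l + eps / 2.
  apply: not_all_not_ex => h.
  suff : l <= l - eps / 2 by lra.
  by apply: lub => x [n ->]; have := h n; lra.
(* A bound for [u r] valid for all remainders [r] modulo [n + 1]. *)
pose C := INR (n.+1 * u 1 + u 0).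
have C0 : 0 <= C by apply: pos_INR.
have [N hN] := INR_unbounded (2 * C / eps).
exists N => k /leP Nk; rewrite /Rdist -/(v k).
have kp := pos1 k.
rewrite Rabs_right; last by have := lv k; lra.
suff : v k <= v n + C / INR k.+1.
  have : C / INR k.+1 < eps / 2.
    have h1 : INR N <= INR k.+1 by apply/INR_leq/(leq_trans Nk).
    have h2 : 2 * C / eps < INR k.+1 by lra.
    have h3 : 2 * C < INR k.+1 * eps.
      have := Rmult_lt_compat_r eps _ _ eps0 h2.
      have -> : 2 * C / eps * eps = 2 * C by field; lra.
      by [].
    apply: (Rmult_lt_reg_r (INR k.+1)) => //.
    have -> : C / INR k.+1 * INR k.+1 = C by field; lra.
    lra.
  lra.
pose q := (k.+1 %/ n.+1)%N; pose r := (k.+1 %% n.+1)%N.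
have Ek : k.+1 = (q * n.+1 + r)%N by apply: divn_eq.
have rn : (r <= n.+1)%N by apply/ltnW/ltn_pmod.
have hr : (u r <= n.+1 * u 1 + u 0)%N.
  have := subadditive_div r 1 0; rewrite muln1 addn0 => h.
  by rewrite (leq_trans h) // leq_add2r leq_mul2r rn orbT.
have h1 : INR (u k.+1) <= INR q * INR (u n.+1) + C.
  rewrite -INR_muln /C -INR_addn; apply: INR_leq; rewrite {1}Ek.
  by rewrite (leq_trans (subadditive_div _ _ _)) // leq_add2l.
have h2 : INR q * INR n.+1 <= INR k.+1.
  by rewrite -INR_muln; apply: INR_leq; rewrite Ek leq_addr.
have Eu : INR (u n.+1) = v n * INR n.+1 by rewrite /v; field; have := pos1 n; lra.
apply: (Rmult_le_reg_r (INR k.+1)) => //.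
have -> : v k * INR k.+1 = INR (u k.+1) by rewrite /v; field; lra.
have -> : (v n + C / INR k.+1) * INR k.+1 = v n * INR k.+1 + C by field; lra.
rewrite Eu in h1; have := v0 n; nra.
Qed.

End Subadditive.

Local Close Scope group_scope.
Delimit Scope R_scope with R.

Theorem theorem4p1 (S : finType) (m : S -> S -> nat)
  (hm_sym : forall s t, m s t = m t s)
  (hm2 : forall s t, s != t -> 2 <= m s t)
  (hfin : coxeter_finite m)
  (d : seq S) (hd : isDelta m d)
  (g : seq (letter S)) (hinf : infinite_order_G m d g) :
  (exists u : nat -> nat, forall n, wordnorm m d (wpow g n) (u n)) /\
  (forall u : nat -> nat, (forall n, wordnorm m d (wpow g n) (u n)) ->
     exists l : R, Un_cv (fun n => (INR (u n.+1) / INR n.+1)%R) l /\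
                   (1 / (2 * INR (size d)) <= l)%R).
Proof.
have [d_atom d_max] := hd.
have d_red : reduced m d by apply/reducedP => v /wcP; apply: d_atom.
have w0_max (x : W m) : len x <= len (wc m d).
  have [v /wcP E vd] := d_max (rw x).
  by rewrite (eqP d_red) -[x]rwK -E (leq_trans (len_min m v)).
(* If Delta were trivial there would be no generators, and the empty word [g] would not have
   infinite order. *)
have d_gt0 : 0 < size d.
  case: (posnP (size d)) => // d0; case: g hinf => [|[s b] g'] h.
    by case: (h 1%N 0%Z) => //; apply: rst_refl.
  by have := w0_max (gen m s); rewrite (eqP d_red) d0 len_gen.
split.
  have h n := ex_wordnorm hm_sym hm2 w0_max erefl d_red d_gt0 (wpow g n).
  by exists (fun n => sval (constructive_indefinite_description _ (h n))) => n;
     case: constructive_indefinite_description.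
move=> u hu.
have [l [cv hl]] := fekete
  (u_sub hm_sym hm2 w0_max erefl d_red d_gt0 hu).
exists l; split=> //; apply: hl => n.
have /INR_leq := u_lower hm_sym hm2 w0_max erefl d_red d_gt0 hinf hu n.+1.
rewrite !INR_muln [INR 2]/=.
have dp : (0 < INR (size d))%R by apply: lt_0_INR; apply/ltP.
have np : (0 < INR n.+1)%R by apply: lt_0_INR; apply/ltP.
move=> h; apply: (Rmult_le_reg_r (INR n.+1 * (2 * INR (size d)))); first nra.
have -> : (1 / (2 * INR (size d)) * (INR n.+1 * (2 * INR (size d))) = INR n.+1)%R.
  by field; lra.
have -> : (INR (u n.+1) / INR n.+1 * (INR n.+1 * (2 * INR (size d))) =
  2 * INR (size d) * INR (u n.+1))%R by field; lra.
by [].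
Qed.
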